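(* Consider the plant $\dot x = Ax+Bu+B_w w$, $z = Cx+Du+D_w w$ with $A$ Hurwitz and constant $w\in\mathcal{W}$, and let all the problem data be as in the context, satisfying the standing assumptions listed there. Let $T=\begin{bmatrix}T_z\\ T_u\end{bmatrix}\in\mathbb{R}^{(r+m)\times q}$ be a matrix of full column rank with $$\mathrm{range}(T)=\mathrm{null}\begin{bmatrix}I_r&-G_u\\ H_z&H_u\end{bmatrix}.$$ Suppose that $N:=H_zG_u+H_u$ has full row rank and that, for each $w\in\mathcal{W}$, the function $\xi\mapsto f_0(T_u\xi+u_0(w))+g_0(T_z\xi+z_0(w))$ is strongly convex on $\Xi_w=\{\xi\in\mathbb{R}^q : T_u\xi+u_0(w)\in\mathcal{U}\}$. Select $K_2\in\mathbb{R}^{m\times n_{\rm c}}$ such that $-NK_2$ is Hurwitz, define $$\Pi_{\rm c}:=I_m-K_2[NK_2]^{-1}N,$$ and finally, for any $P\succ0$ ($P\in\mathbb{R}^{q\times q}$), select $K_1\in\mathbb{R}^{m\times q}$ of full column rank such that $\Pi_{\rm c}K_1=T_uP$. Then the controller $$\tau_1\dot\eta_1=-T_u^{\mathsf T}\nabla f_0(u)-T_z^{\mathsf T}\nabla g_0(z),\qquad \tau_2\dot\eta_2=-(H_zz+H_uu+H_ww),\qquad u=K_1\eta_1+K_2\eta_2$$ solves the OSS control problem for all tunings of the form $\tau_1\gg\tau_2\gg0$; that is, there exists $\tau_2^\star>0$ such that for every $\tau_2>\tau_2^\star$ there exists $\tau_1^\star>0$ (possibly depending on $\tau_2$) such that for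 every $\tau_1>\tau_1^\star$ the controller solves the OSS control problem.
   Context: Plant: $x(t)\in\mathbb{R}^n$ is the state, $z(t)\in\mathbb{R}^r$ the measured output, $u(t)\in\mathbb{R}^m$ the control input, and $w\in\mathcal{W}\subset\mathbb{R}^{n_w}$ a constant exogenous signal: $\dot x = Ax+Bu+B_ww$, $z=Cx+Du+D_ww$, with $A$ Hurwitz. The DC gain matrices are $G_u=-CA^{-1}B+D\in\mathbb{R}^{r\times m}$ and $G_w=-CA^{-1}B_w+D_w\in\mathbb{R}^{r\times n_w}$, so that at equilibrium $\bar z=G_u\bar u+G_ww$. Steady-state optimization problem (for given $w$): $$\text{minimize}_{\bar z,\bar u}\ f_0(\bar u)+g_0(\bar z)\quad\text{subject to}\quad \bar z=G_u\bar u+G_ww,\quad 0=H_z\bar z+H_u\bar u+H_ww,$$ where $H_z\in\mathbb{R}^{n_{\rm c}\times r}$, $H_u\in\mathbb{R}^{n_{\rm c}\times m}$, $H_w\in\mathbb{R}^{n_{\rm c}\times n_w}$, and $f_0$, $g_0$ are convex cost functions defined on closed non-empty convex sets $\mathcal{U}\subseteq\mathbb{R}^m$ and $\mathcal{Z}\subseteq\mathbb{R}^r$ respectively. They may contain barrier terms, so they are finite on the interiors of their domains and may take the value $+\infty$ on the boundary. OSS (optimal steady-state) control problem: a controller solves it if, for each $w\in\mathcal{W}$, the closed-loop system of plant and controller possesses a unique locally exponentially stable equilibrium point, and the corresponding equilibrium pair $(\bar u,\bar z)$ is an optimal point of the optimization problem above. Standing assumptions: on the interiors of their domains, $f_0$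 and $g_0$ are convex, continuously differentiable, and have at least locally Lipschitz continuous gradients; $\mathcal{W}$ is convex and compact; the optimization problem is strictly feasible and has an optimal solution for all $w\in\mathcal{W}$; both $z(t)$ and $H_zz(t)+H_uu(t)+H_ww$ are measurable (available to the controller). Notation: $T_z\in\mathbb{R}^{r\times q}$, $T_u\in\mathbb{R}^{m\times q}$. For each $w$, $(z_0(w),u_0(w))$ denotes any solution $(\bar z,\bar u)$ of the linear constraints $$\begin{bmatrix}I_r&-G_u\\ H_z&H_u\end{bmatrix}\begin{bmatrix}\bar z\\ \bar u\end{bmatrix}=\begin{bmatrix}G_w\\ -H_w\end{bmatrix}w,$$ so that the solution set of the constraints is $\{(T_z\xi+z_0(w),\,T_u\xi+u_0(w)):\xi\in\mathbb{R}^q\}$. $P\succ0$ means symmetric positive definite. The controller states are $\eta_1\in\mathbb{R}^q$, $\eta_2\in\mathbb{R}^{n_{\rm c}}$, and $\tau_1,\tau_2>0$ are time constants.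
   Formalization: It is also assumed that for each w every optimal point lies in the interiors of U and Z; otherwise the claim fails, e.g. f0(u)=u+u² on U=[0,∞), g0=0, no engineering constraints: the optimum u=0 is on the boundary and the controller has no equilibrium. *)

(* Defs.v *)
From HB Require Import structures.
From mathcomp Require Import all_boot all_order all_algebra.
From mathcomp Require Import all_classical all_reals all_analysis.
From mathcomp Require Import complex.

Set Implicit Arguments.
Unset Strict Implicit.
Unset Printing Implicit Defensive.

Import Order.TTheory GRing.Theory Num.Theory.
Import numFieldNormedType.Exports.

Local Open Scope classical_set_scope.
Local Open Scope ring_scope.

Definition hurwitz (R : realType) (n : nat) (A : 'M[R]_n) : Prop :=
  forall l : R[i], eigenvalue (map_mx (real_complex R) A) l ->
    complex.Re l < 0.

Definition posdef (R : realType) (n : nat) (P : 'M[R]_n) : Prop :=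
  P^T = P /\ forall v : 'cV[R]_n, v != 0 -> 0 < (v^T *m P *m v) 0 0.

(* The library norm on ['cV[R]_n] is the sup norm, so the Euclidean one is
   written out. *)
Definition sqnorm2 (R : realType) (n : nat) (v : 'cV[R]_n) : R :=
  \sum_(i < n) v i 0 ^+ 2.

(* Convexity of extended-real-valued functions.  The functions considered never
   take the value -oo, so none of the sums below is indeterminate. *)
Definition convex_on (R : realType) (n : nat) (X : set 'cV[R]_n)
    (f : 'cV[R]_n -> \bar R) : Prop :=
  forall x y, X x -> X y -> forall t : R, 0 < t -> t < 1 ->
    (f (t *: x + (1 - t) *: y)%R <= t%:E * f x + (1 - t)%:E * f y)%E.

Definition strongly_convex_on (R : realType) (n : nat) (X : set 'cV[R]_n)
    (f : 'cV[R]_n -> \bar R) : Prop :=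
  exists2 mu : R, 0 < mu &
  forall x y, X x -> X y -> forall t : R, 0 < t -> t < 1 ->
    (f (t *: x + (1 - t) *: y)%R <=
     t%:E * f x + (1 - t)%:E * f y
     - (mu / 2 * t * (1 - t) * sqnorm2 (x - y)%R)%:E)%E.

(* Meaningful only where [f] is finite around [x] and [fine \o f] is
   differentiable at [x]. *)
Definition gradient (R : realType) (n : nat) (f : 'cV[R]_n -> \bar R)
    (x : 'cV[R]_n) : 'cV[R]_n :=
  \col_(i < n) 'D_(delta_mx i 0) (fine \o f) x.

(* A cost function with domain [X] is extended by +oo outside [X]; it may also
   be +oo on the boundary of [X].  The library's [locally [lipschitz ..]] speaks
   of all pairs of points of the set; the pairs (x, x) give the textbook notion,
   which implies the condition at the other pairs. *)
Record convex_cost (R : realType) (n : nat) (X : set 'cV[R]_n)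
    (f : 'cV[R]_n -> \bar R) : Prop := ConvexCost {
  cost_closed : closed X ;
  cost_nonempty : X !=set0 ;
  cost_convex_dom : convex_set X ;
  cost_notNy : forall x, f x != -oo%E ;
  cost_out : forall x, ~ X x -> f x = +oo%E ;
  cost_fin : forall x, X° x -> f x \is a fin_num ;
  cost_convex : convex_on X f ;
  cost_diff : forall x, X° x -> differentiable (fine \o f) x ;
  cost_grad_cont : forall x, X° x -> {for x, continuous (gradient f)} ;
  cost_grad_lip : [locally [lipschitz (gradient f) x | x in X°]]
}.

Section Dynamics.
Variables (R : realType) (X : normedModType R).
(* the autonomous system x' = F x on the domain [dom] *)
Variables (dom : set X) (F : X -> X).

(* [x] solves x' = F x on [0, b[, with [b = +oo] allowed.  The equation is
   required at positive times: for [F] continuous it then also holds, one-sided,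
   at time 0.  The values of [x] outside [0, b[ are irrelevant. *)
Definition solution (b : \bar R) (x : R -> X) : Prop :=
  [/\ {within [set t : R | 0 <= t /\ (t%:E < b)%E], continuous x},
      forall t : R, 0 <= t -> (t%:E < b)%E -> dom (x t) &
      forall t : R, 0 < t -> (t%:E < b)%E -> is_derive t 1 x (F (x t))].

Definition equilibrium (p : X) : Prop := dom p /\ F p = 0.

(* Trajectories starting near [p] exist for all times (inside [dom]), and every
   trajectory starting there, on whatever time interval, decays exponentially.
   In finite dimension the choice of the norm is immaterial. *)
Definition locally_exp_stable (p : X) : Prop :=
  exists delta c lam : R, [/\ 0 < delta, 0 < c, 0 < lam &
    forall p0 : X, `|p0 - p| < delta ->
      (exists2 x : R -> X, solution +oo%E x & x 0 = p0) /\
      (forall (b : \bar R) (x : R -> X), (0 < b)%E -> solution b x ->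
        x 0 = p0 -> forall t : R, 0 <= t -> (t%:E < b)%E ->
        `|x t - p| <= c * expR (- (lam * t)) * `|p0 - p|)].

End Dynamics.

(* x' = A x + B u + Bw w,  z = C x + D u + Dw w *)
Record plant (R : realType) (n m r nw : nat) := Plant {
  plA : 'M[R]_n ; plB : 'M[R]_(n, m) ; plBw : 'M[R]_(n, nw) ;
  plC : 'M[R]_(r, n) ; plD : 'M[R]_(r, m) ; plDw : 'M[R]_(r, nw)
}.

Definition dcgain_u (R : realType) (n m r nw : nat) (S : plant R n m r nw) :
    'M[R]_(r, m) :=
  - (plC S *m invmx (plA S) *m plB S) + plD S.

Definition dcgain_w (R : realType) (n m r nw : nat) (S : plant R n m r nw) :
    'M[R]_(r, nw) :=
  - (plC S *m invmx (plA S) *m plBw S) + plDw S.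

(* [ossU], [ossZ] are the domains of the costs [ossf], [ossg]; [ossW] is the set
   of exogenous signals. *)
Record oss_problem (R : realType) (m r nw nc : nat) := OssProblem {
  ossHz : 'M[R]_(nc, r) ; ossHu : 'M[R]_(nc, m) ; ossHw : 'M[R]_(nc, nw) ;
  ossU : set 'cV[R]_m ; ossf : 'cV[R]_m -> \bar R ;
  ossZ : set 'cV[R]_r ; ossg : 'cV[R]_r -> \bar R ;
  ossW : set 'cV[R]_nw
}.

Section Optimization.
Variables (R : realType) (n m r nw nc : nat).
Variables (S : plant R n m r nw) (O : oss_problem R m r nw nc).

Definition constraints (w : 'cV[R]_nw) (z : 'cV[R]_r) (u : 'cV[R]_m) : Prop :=
  z = dcgain_u S *m u + dcgain_w S *m w /\
  0 = ossHz O *m z + ossHu O *m u + ossHw O *m w.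

Definition feasible (w : 'cV[R]_nw) (z : 'cV[R]_r) (u : 'cV[R]_m) : Prop :=
  [/\ ossZ O z, ossU O u & constraints w z u].

Definition strictly_feasible (w : 'cV[R]_nw) (z : 'cV[R]_r) (u : 'cV[R]_m)
    : Prop :=
  [/\ (ossZ O)° z, (ossU O)° u & constraints w z u].

Definition optimal (w : 'cV[R]_nw) (z : 'cV[R]_r) (u : 'cV[R]_m) : Prop :=
  feasible w z u /\ forall z' u', feasible w z' u' ->
    (ossf O u + ossg O z <= ossf O u' + ossg O z')%E.

End Optimization.

(* A dynamic output-feedback controller with state space [E]:
   eta' = ctrl_rhs eta z e,  u = ctrl_out eta, where z is the measured output
   and e = Hz z + Hu u + Hw w.  The right-hand side is meaningful only on the
   pairs (eta, z) in [ctrl_dom]. *)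
Record controller (R : realType) (m r nc : nat) (E : normedModType R) :=
  Controller {
  ctrl_dom : set (E * 'cV[R]_r) ;
  ctrl_rhs : E -> 'cV[R]_r -> 'cV[R]_nc -> E ;
  ctrl_out : E -> 'cV[R]_m
}.

Section ClosedLoop.
Variables (R : realType) (n m r nw nc : nat) (E : normedModType R).
Variables (S : plant R n m r nw) (O : oss_problem R m r nw nc).
Variables (K : controller m r nc E) (w : 'cV[R]_nw).

Definition cl_u (s : 'cV[R]_n * E) : 'cV[R]_m := ctrl_out K s.2.

Definition cl_z (s : 'cV[R]_n * E) : 'cV[R]_r :=
  plC S *m s.1 + plD S *m cl_u s + plDw S *m w.

Definition cl_e (s : 'cV[R]_n * E) : 'cV[R]_nc :=
  ossHz O *m cl_z s + ossHu O *m cl_u s + ossHw O *m w.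

Definition cl_dom : set ('cV[R]_n * E) :=
  [set s | ctrl_dom K (s.2, cl_z s)].

Definition cl_field (s : 'cV[R]_n * E) : 'cV[R]_n * E :=
  (plA S *m s.1 + plB S *m cl_u s + plBw S *m w,
   ctrl_rhs K s.2 (cl_z s) (cl_e s)).

End ClosedLoop.

Definition solves_OSS (R : realType) (n m r nw nc : nat) (E : normedModType R)
    (S : plant R n m r nw) (O : oss_problem R m r nw nc)
    (K : controller m r nc E) : Prop :=
  forall w, ossW O w -> exists p : 'cV[R]_n * E,
    [/\ equilibrium (cl_dom S K w) (cl_field S O K w) p,
        forall p', equilibrium (cl_dom S K w) (cl_field S O K w) p' -> p' = p,
        locally_exp_stable (cl_dom S K w) (cl_field S O K w) p &
        optimal S O w (cl_z S K w p) (cl_u K p)].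

(* The standing assumptions.  [ass_interior] says that the optimum is not on the
   boundary of the domains of the costs, where the costs need not have gradients;
   it holds automatically for costs that are infinite on these boundaries. *)
Record standing_assumptions (R : realType) (n m r nw nc : nat)
    (S : plant R n m r nw) (O : oss_problem R m r nw nc) : Prop :=
  StandingAssumptions {
  ass_f : convex_cost (ossU O) (ossf O) ;
  ass_g : convex_cost (ossZ O) (ossg O) ;
  ass_W_convex : convex_set (ossW O) ;
  ass_W_compact : compact (ossW O) ;
  ass_slater : forall w, ossW O w -> exists z u, strictly_feasible S O w z u ;
  ass_optimal : forall w, ossW O w -> exists z u, optimal S O w z u ;
  ass_interior : forall w z u, ossW O w -> optimal S O w z u ->
    (ossZ O)° z /\ (ossU O)° u
}.

(* tau1 eta1' = - Tu^T (grad f0)(u) - Tz^T (grad g0)(z),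
   tau2 eta2' = - e,  u = K1 eta1 + K2 eta2,
   defined where both gradients are. *)
Definition gradient_controller (R : realType) (m r nw nc q : nat)
    (O : oss_problem R m r nw nc)
    (Tz : 'M[R]_(r, q)) (Tu : 'M[R]_(m, q))
    (K1 : 'M[R]_(m, q)) (K2 : 'M[R]_(m, nc)) (tau1 tau2 : R) :
    controller m r nc ('cV[R]_q * 'cV[R]_nc)%type :=
  let out (eta : 'cV[R]_q * 'cV[R]_nc) := K1 *m eta.1 + K2 *m eta.2 in
  {| ctrl_dom := [set p | (ossU O)° (out p.1) /\ (ossZ O)° p.2] ;
     ctrl_rhs := fun eta z e =>
       (tau1^-1 *: (- (Tu^T *m gradient (ossf O) (out eta))
                    - Tz^T *m gradient (ossg O) z),
        tau2^-1 *: (- e)) ;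
     ctrl_out := out |}.

(* Main.v *)
Require Import Defs.
From HB Require Import structures.
From mathcomp Require Import all_boot all_order all_algebra.
From mathcomp Require Import all_classical all_reals all_analysis.
From mathcomp Require Import complex ring lra.

Set Implicit Arguments.
Unset Strict Implicit.
Unset Printing Implicit Defensive.

Import Order.TTheory GRing.Theory Num.Theory.
Import numFieldNormedType.Exports.

Local Open Scope classical_set_scope.
Local Open Scope ring_scope.


(** In the coordinates y2 = eta2 + J eta1, with J = (N K2)^-1 N K1, and y1, the
    deviation of the plant state from its steady state for the current input, the
    choice of K1 gives, for the deviations from an equilibrium,
<<
      du = Tu xi + K2 y2,      dz = Tz xi + C y1 + Gu K2 y2,      xi = P eta1.
>>
    So eta1 moves input and output along the constraint set, while y1 and y2
    measure how far the plant is from rest and the pair (z, u) from the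
    constraints.  The fast variables obey linear equations governed by A and, on
    the time scale tau2, by - N K2; eta1 drifts on the slower time scale tau1
    against the gradient of the cost in xi.

    The equilibria are the points whose input and output satisfy the first-order
    optimality conditions.  By convexity these are the optimizers
    ([stationary_optimal], [optimal_stationary]); an optimizer exists by assumption
    and is unique by strong convexity ([optimal_unique]).

    Stability is shown with one quadratic form,
<<
      V = (eta1, P eta1) / 2 + (y1, Q1 y1) + (y2, Q2 y2),
>>
    all variables being deviations from the equilibrium, where Q1 and Q2 are
    Lyapunov matrices of A and - N K2 ([hurwitz_lyapunov]).  For tau2 large the
    coupling of y1 and y2 is absorbed by their own decay.  With the weight P, the
    slow part of the derivative of V contains the inner products of the gradient
    increments gf, gg with du, dz.  Gradients of convex functions are cocoercive
    ([cocoercive]): these products are at least kap (|gf|^2 + |gg|^2).  This absorbs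
    the remaining cross terms for tau1 large, which leaves a decay of V in y1, y2,
    gf and gg ([lyap_rate_decay]).  The threshold for tau1 involves only kap, that
    is, a Lipschitz constant of the gradients near the optimizers, and not the
    modulus of strong convexity, for which no lower bound over all signals w is
    assumed.  The Lipschitz constant can be taken the same for all w by compactness
    of W, since the optimizer moves continuously with w ([uniform_smoothness]).

    For a fixed w strong convexity bounds eta1 by y1, y2, gf and gg
    ([slow_bound]), so that V decays exponentially.  That this implies local
    exponential stability is [lyapunov_exp_stable]; the existence of trajectories
    comes from Picard iteration ([picard_lindelof]). *)

(** * The Euclidean inner product *)

Section Euclidean.
Variable R : realType.
Implicit Types n m : nat.

Definition dot n (u v : 'cV[R]_n) : R := (u^T *m v) 0 0.

Lemma dotE n (u v : 'cV[R]_n) : dot u v = \sum_i u i 0 * v i 0.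
Proof. by rewrite /dot mxE; apply: eq_bigr => i _; rewrite mxE. Qed.

Lemma sqnorm2E n (v : 'cV[R]_n) : sqnorm2 v = dot v v.
Proof. by rewrite dotE; apply: eq_bigr => i _; rewrite expr2. Qed.

Lemma dotC n (u v : 'cV[R]_n) : dot u v = dot v u.
Proof. by rewrite !dotE; apply: eq_bigr => i _; rewrite mulrC. Qed.

Lemma dotDl n (u v w : 'cV[R]_n) : dot (u + v) w = dot u w + dot v w.
Proof. by rewrite /dot linearD mulmxDl mxE. Qed.

Lemma dotDr n (u v w : 'cV[R]_n) : dot w (u + v) = dot w u + dot w v.
Proof. by rewrite /dot mulmxDr mxE. Qed.

Lemma dotZl n (a : R) (u v : 'cV[R]_n) : dot (a *: u) v = a * dot u v.
Proof. by rewrite /dot linearZ -scalemxAl mxE. Qed.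

Lemma dotZr n (a : R) (u v : 'cV[R]_n) : dot u (a *: v) = a * dot u v.
Proof. by rewrite dotC dotZl dotC. Qed.

Lemma dotNl n (u v : 'cV[R]_n) : dot (- u) v = - dot u v.
Proof. by rewrite -scaleN1r dotZl mulN1r. Qed.

Lemma dotNr n (u v : 'cV[R]_n) : dot u (- v) = - dot u v.
Proof. by rewrite dotC dotNl dotC. Qed.

Lemma dotBl n (u v w : 'cV[R]_n) : dot (u - v) w = dot u w - dot v w.
Proof. by rewrite dotDl dotNl. Qed.

Lemma dotBr n (u v w : 'cV[R]_n) : dot w (u - v) = dot w u - dot w v.
Proof. by rewrite dotDr dotNr. Qed.

Lemma dot0l n (v : 'cV[R]_n) : dot 0 v = 0.
Proof. by rewrite -(scale0r 0) dotZl mul0r. Qed.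

Lemma dot0r n (v : 'cV[R]_n) : dot v 0 = 0.
Proof. by rewrite dotC dot0l. Qed.

Definition dot_lin := (dotDl, dotDr, dotBl, dotBr, dotNl, dotNr, dotZl, dotZr).

Lemma dot_mulmxl n m (M : 'M[R]_(n, m)) (u : 'cV[R]_m) (v : 'cV[R]_n) :
  dot (M *m u) v = dot u (M^T *m v).
Proof. by rewrite /dot trmx_mul mulmxA. Qed.

Lemma sqnorm2_ge0 n (v : 'cV[R]_n) : 0 <= sqnorm2 v.
Proof. by apply: sumr_ge0 => i _; rewrite sqr_ge0. Qed.

Lemma sqnorm2_eq0 n (v : 'cV[R]_n) : sqnorm2 v = 0 -> v = 0.
Proof.
move=> /eqP; rewrite psumr_eq0; last by move=> i _; rewrite sqr_ge0.
move=> /allP v0; apply/colP => i; rewrite mxE; apply/eqP.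
by rewrite -[_ == _]sqrf_eq0; apply: v0; rewrite mem_index_enum.
Qed.

Lemma sqnorm2_0 n : sqnorm2 (0 : 'cV[R]_n) = 0.
Proof. by rewrite sqnorm2E dot0l. Qed.

Lemma sqnorm2Z n (a : R) (v : 'cV[R]_n) : sqnorm2 (a *: v) = a ^+ 2 * sqnorm2 v.
Proof. by rewrite !sqnorm2E !dot_lin mulrA expr2. Qed.

Lemma sqnorm2N n (v : 'cV[R]_n) : sqnorm2 (- v) = sqnorm2 v.
Proof. by rewrite !sqnorm2E !dot_lin opprK. Qed.

Lemma young n (t : R) (u v : 'cV[R]_n) : 0 < t ->
  2 * dot u v <= t * sqnorm2 u + t^-1 * sqnorm2 v.
Proof.
move=> t0; rewrite -subr_ge0.
suff -> : t * sqnorm2 u + t^-1 * sqnorm2 v - 2 * dot u v =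
          t^-1 * sqnorm2 (t *: u - v).
  by rewrite mulr_ge0 ?sqnorm2_ge0// invr_ge0 ltW.
by rewrite !sqnorm2E !dot_lin (dotC v u); field; rewrite gt_eqF.
Qed.

Lemma sqnorm2D n (u v : 'cV[R]_n) :
  sqnorm2 (u + v) <= 2 * (sqnorm2 u + sqnorm2 v).
Proof.
have := @young n 1 u v ltr01; rewrite invr1 !mul1r.
by rewrite [sqnorm2 (u + v)]sqnorm2E !dot_lin -!sqnorm2E (dotC v u); lra.
Qed.

Lemma cauchy_schwarz n (u v : 'cV[R]_n) :
  dot u v ^+ 2 <= sqnorm2 u * sqnorm2 v.
Proof.
have [v0|v0] := eqVneq (sqnorm2 v) 0.
  by rewrite (sqnorm2_eq0 v0) dot0r sqnorm2_0 mulr0 expr0n.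
have vp : 0 < sqnorm2 v by rewrite lt0r v0 sqnorm2_ge0.
rewrite -subr_ge0 -(pmulr_rge0 _ vp).
suff -> : sqnorm2 v * (sqnorm2 u * sqnorm2 v - dot u v ^+ 2) =
          sqnorm2 (sqnorm2 v *: u - dot u v *: v) by exact: sqnorm2_ge0.
by rewrite [sqnorm2 (_ - _)]sqnorm2E !dot_lin -!sqnorm2E (dotC v u); ring.
Qed.

Lemma sqnorm2_mulmx n m (M : 'M[R]_(n, m)) :
  exists2 C : R, 0 < C & forall v, sqnorm2 (M *m v) <= C * sqnorm2 v.
Proof.
exists (1 + \sum_i sqnorm2 (row i M)^T).
  by rewrite ltr_wpDr// sumr_ge0// => i _; exact: sqnorm2_ge0.
move=> v; rewrite mulrDl mul1r mulr_suml -[leLHS]add0r.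
apply: lerD; first exact: sqnorm2_ge0.
apply: ler_sum => i _; apply: le_trans (cauchy_schwarz _ _).
by rewrite /dot trmxK -row_mul [in leRHS]mxE.
Qed.

Lemma dot_mulmx_bound n m (M : 'M[R]_(n, m)) :
  exists2 C : R, 0 < C & forall u v (t : R), 0 < t ->
    `|dot u (M *m v)| <= t * sqnorm2 u + C / t * sqnorm2 v.
Proof.
have [C C0 MC] := sqnorm2_mulmx M; exists C => // u v t t0.
have tv : t^-1 * sqnorm2 (M *m v) <= C / t * sqnorm2 v.
  by rewrite mulrAC mulrC ler_pM2r ?invr_gt0.
have tu : 0 <= t * sqnorm2 u by rewrite mulr_ge0 ?sqnorm2_ge0// ltW.
have tC : 0 <= C / t * sqnorm2 v.
  by rewrite mulr_ge0 ?sqnorm2_ge0// divr_ge0 ?ltW.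
have := @young n t u (M *m v) t0; have := @young n t (- u) (M *m v) t0.
by rewrite sqnorm2N dotNl ler_norml => *; apply/andP; split; lra.
Qed.

End Euclidean.

(** * Quadratic Lyapunov functions of Hurwitz matrices *)

Section Hurwitz.
Variable R : realType.

Lemma hurwitz_unit n (A : 'M[R]_n) : hurwitz A -> A \in unitmx.
Proof.
move=> hA; rewrite -(map_unitmx (real_complex R)).
apply: contraT => nu; suff /hA : eigenvalue (map_mx (real_complex R) A) 0.
  by rewrite ltxx.
by rewrite /eigenvalue /eigenspace raddf0 subr0 kermx_eq0 row_free_unit.
Qed.

Lemma min_pos n (f : 'I_n -> R) : (forall i, 0 < f i) ->
  exists2 a, 0 < a & forall i, a <= f i.
Proof.
move=> f0; exists (\big[Num.min/1]_i f i).
  by elim/big_rec: _ => // i x _ x0; rewrite lt_min f0.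
by move=> i; exact: bigmin_le_cond.
Qed.

(** By Schur's theorem A is similar to a complex triangular matrix with the
    eigenvalues on the diagonal.  Conjugating by diag(1, rho, rho^2, ..) multiplies
    the entry (i, j) by rho^(i-j), which makes the part below the diagonal as small
    as desired. *)
Lemma hurwitz_almost_diagonal n (A : 'M[R]_n) : hurwitz A ->
  exists2 a : R, 0 < a & forall e : R, 0 < e ->
  exists S T : 'M[R[i]]_n, [/\ S \in unitmx,
    S *m map_mx (real_complex R) A = T *m S,
    forall i, complex.Re (T i i) <= - a &
    forall i j, i != j ->
      `|complex.Re (T i j)| <= e /\ `|complex.Im (T i j)| <= e].
Proof.
case: n A => [|n] A hA.
  exists 1 => // e _; exists 1%:M, 0; split; [exact: unitmx1| |by case|by case].
  by apply/matrixP => - [].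
set AC := map_mx _ _.
have [P /unitarymx_unit uP simPA] := @Schur R[i] n.+1 AC isT.
set T := conjmx P AC in simPA.
have PA : P *m AC = T *m P by rewrite /T conjumx // mulmxKV.
have trigT : forall i j : 'I_n.+1, (i < j)%N -> T i j = 0 by exact/is_trig_mxP.
have eigT i : complex.Re (T i i) < 0.
  apply: hA; have : eigenvalue T (T i i).
    rewrite eigenvalue_root_char char_poly_trig//.
    rewrite /root horner_prod; apply/eqP; rewrite (bigD1 i)//=.
    by rewrite !hornerE subrr mul0r.
  move=> /eigenvalueP[v vT v0]; apply/eigenvalueP; exists (v *m P).
    by rewrite -mulmxA PA mulmxA vT scalemxAl.
  by apply: contraNneq v0 => vP; rewrite -[v](mulmxK uP) vP mul0mx.
have [a a0 aT] : exists2 a, 0 < a & forall i, a <= - complex.Re (T i i).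
  by apply: min_pos => i; rewrite oppr_gt0.
exists a => // e e0.
clearbody T AC.
pose b := 1 + \sum_i \sum_j (`|complex.Re (T i j)| + `|complex.Im (T i j)|).
have sum0 i : 0 <= \sum_j (`|complex.Re (T i j)| + `|complex.Im (T i j)|).
  by apply: sumr_ge0 => j _; rewrite addr_ge0.
have b0 : 0 < b by rewrite ltr_wpDr// sumr_ge0.
have bT i j : `|complex.Re (T i j)| + `|complex.Im (T i j)| <= b.
  apply: (@le_trans _ _
      (\sum_j (`|complex.Re (T i j)| + `|complex.Im (T i j)|))).
    by rewrite (bigD1 j)//= lerDl sumr_ge0// => k _; rewrite addr_ge0.
  by rewrite /b [in leRHS](bigD1 i)//= addrCA lerDl addr_ge0// sumr_ge0.
pose rho := Num.min 1 (e / b).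
have rho0 : 0 < rho by rewrite lt_min ltr01 divr_gt0.
have rho1 : rho <= 1 by rewrite ge_min lexx.
have rhob : rho * b <= e by rewrite -ler_pdivlMr// ge_min lexx orbT.
have c1 : real_complex R 1 = 1 by exact: rmorph1.
pose D : 'M[R[i]]_n.+1 := diag_mx (\row_i real_complex R (rho ^+ i)).
pose T' : 'M[R[i]]_n.+1 := \matrix_(i, j) (real_complex R (rho ^+ i / rho ^+ j) * T i j).
have T'D : T' *m D = D *m T.
  apply/matrixP => i j; rewrite mul_mx_diag mul_diag_mx !mxE mulrAC -rmorphM/=.
  by rewrite divfK// expf_neq0// gt_eqF.
have uD : D \in unitmx.
  rewrite unitmxE det_diag unitfE; apply/prodf_neq0 => i _.
  by rewrite mxE fmorph_eq0 expf_neq0// gt_eqF.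
have T'E i j : T' i j = real_complex R (rho ^+ i / rho ^+ j) * T i j.
  by rewrite mxE.
clearbody D T'; exists (D *m P), T'; split.
- by rewrite unitmx_mul uP andbT.
- by rewrite -mulmxA PA mulmxA T'D mulmxA.
- move=> i; rewrite T'E divff ?expf_neq0 ?gt_eqF// c1 mul1r.
  by rewrite lerNr.
- move=> i j ij; rewrite T'E.
  have [lij|lji] : (i < j \/ j < i)%N.
    by move: ij; rewrite neq_ltn => /orP[]; [left|right].
    by rewrite trigT// mulr0 /= normr0 ltW.
  have scale_le (x y : R) : `|x| + `|y| <= b ->
      `|rho ^+ i / rho ^+ j * x| <= e.
    move=> xyb; rewrite normrM -expfB// [`|rho ^+ _|]ger0_norm ?exprn_ge0 ?(ltW rho0)//.
    apply: le_trans rhob; apply: ler_pM => //.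
      by rewrite exprn_ge0 ?(ltW rho0).
      rewrite -(prednK (n := i - j)) ?subn_gt0// exprS ler_piMr ?(ltW rho0)//.
      by rewrite exprn_ile1 ?(ltW rho0).
    by apply: le_trans xyb; rewrite lerDl.
  case: (T i j) (bT i j) => x y /= xyb; split.
    by rewrite mul0r subr0; exact: scale_le xyb.
  by rewrite mul0r addr0; apply: (@scale_le y x); rewrite addrC.
Qed.

(** In the coordinates S of the almost diagonal form the squared length is a
    Lyapunov function; S is complex, and Q collects the real and the imaginary
    part of S v for real v. *)
Lemma hurwitz_lyapunov n (A : 'M[R]_n) : hurwitz A ->
  exists (Q : 'M[R]_n) (c : R), [/\ Q^T = Q, 0 < c,
    forall v, c * sqnorm2 v <= dot v (Q *m v) &
    forall v, dot v (Q *m (A *m v)) <= - (c * sqnorm2 v)].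
Proof.
move=> hA; have [a a0 diagA] := hurwitz_almost_diagonal hA.
(* so small that the off-diagonal entries use up at most half of the decay *)
pose e := a / (4 * n.+1%:R).
have e0 : 0 < e by rewrite divr_gt0// mulr_gt0// ltr0n.
have [S [T [uS SA Tdiag Toff]]] := diagA e e0.
pose re (M : 'M[R[i]]_n) := map_mx (@complex.Re R) M.
pose im (M : 'M[R[i]]_n) := map_mx (@complex.Im R) M.
have Re_sum (I : finType) (F : I -> R[i]) :
    complex.Re (\sum_i F i) = \sum_i complex.Re (F i).
  by elim/big_rec2: _ => // i x [y1 y2] _ <-; case: (F i).
have Im_sum (I : finType) (F : I -> R[i]) :
    complex.Im (\sum_i F i) = \sum_i complex.Im (F i).
  by elim/big_rec2: _ => // i x [y1 y2] _ <-; case: (F i).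
have reM X Y : re (X *m Y) = re X *m re Y - im X *m im Y.
  apply/matrixP => i j; rewrite !mxE Re_sum -sumrB; apply: eq_bigr => k _.
  by rewrite !mxE; case: (X i k) (Y k j) => ? ? [].
have imM X Y : im (X *m Y) = re X *m im Y + im X *m re Y.
  apply/matrixP => i j; rewrite !mxE Im_sum -big_split; apply: eq_bigr => k _.
  by rewrite !mxE; case: (X i k) (Y k j) => ? ? [].
have reA : re (map_mx (real_complex R) A) = A by apply/matrixP => i j; rewrite !mxE.
have imA : im (map_mx (real_complex R) A) = 0 by apply/matrixP => i j; rewrite !mxE.
have re1 : re 1%:M = 1%:M.
  by apply/matrixP => i j; rewrite !mxE; case: (i == j).
have S1A : re S *m A = re T *m re S - im T *m im S.
  by have := congr1 re SA; rewrite !reM reA imA mulmx0 subr0.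
have S2A : im S *m A = re T *m im S + im T *m re S.
  by have := congr1 im SA; rewrite !imM reA imA mulmx0 add0r.
have [C1 C10 U1] := sqnorm2_mulmx (re (invmx S)).
have [C2 C20 U2] := sqnorm2_mulmx (- im (invmx S)).
pose c := (2 * (C1 + C2))^-1.
have c0 : 0 < c by rewrite invr_gt0 mulr_gt0// addr_gt0.
have lower v : c * sqnorm2 v <= sqnorm2 (re S *m v) + sqnorm2 (im S *m v).
  rewrite mulrC ler_pdivrMr ?mulr_gt0 ?addr_gt0//.
  have vE : v = re (invmx S) *m (re S *m v) + (- im (invmx S)) *m (im S *m v).
    by rewrite !mulmxA -mulmxDl mulNmx -reM mulVmx// re1 mul1mx.
  rewrite {1}vE; apply: le_trans (sqnorm2D _ _) _.
  have := U1 (re S *m v); have := U2 (im S *m v).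
  have := sqnorm2_ge0 (re S *m v); have := sqnorm2_ge0 (im S *m v).
  by nra.
pose Q := (re S)^T *m re S + (im S)^T *m im S.
have dotQ u v : dot u (Q *m v) =
    dot (re S *m u) (re S *m v) + dot (im S *m u) (im S *m v).
  by rewrite mulmxDl dotDr -!mulmxA !dot_mulmxl.
pose k := Num.min 1 (a / 2).
have k0 : 0 < k by rewrite lt_min ltr01 divr_gt0.
have [k1 ka] : k <= 1 /\ k <= a / 2 by rewrite !ge_min !lexx orbT.
have ck0 : 0 < c * k by rewrite mulr_gt0.
exists Q, (c * k); split => // [|v|v].
- by rewrite linearD/= !trmx_mul !trmxK.
- rewrite dotQ -!sqnorm2E; apply: le_trans (lower v).
  by rewrite -mulrA ler_pM2l// ler_piMl// sqnorm2_ge0.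
rewrite dotQ !mulmxA S1A S2A mulmxBl mulmxDl -!mulmxA.
have := lower v; move: (re S *m v) (im S *m v) => x y low.
pose s i := x i 0 ^+ 2 + y i 0 ^+ 2.
have s0 i : 0 <= s i by rewrite addr_ge0 ?sqr_ge0.
have bound (t p q : R) : - e <= t -> t <= e ->
    t * (p * q) <= e * (p ^+ 2 + q ^+ 2) / 2.
  by move=> *; have := sqr_ge0 (p + q); have := sqr_ge0 (p - q); nra.
have entry i j : x i 0 * (re T i j * x j 0 - im T i j * y j 0) +
    y i 0 * (re T i j * y j 0 + im T i j * x j 0) <=
    (if j == i then - a * s i else 0) + e * (s i + s j).
  rewrite [re T i j]mxE [im T i j]mxE; have [<-|ij] := eqVneq i j.
    have := Tdiag i; have := s0 i; rewrite /s.
    by move: (complex.Re _) (complex.Im _) (x i 0) (y i 0) e0 => *; nra.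
  have [] := Toff i j ij; rewrite /s add0r !ler_norml.
  move: (complex.Re _) (complex.Im _) (x i 0) (y i 0) (x j 0) (y j 0).
  move=> t1 t2 x1 y1 x2 y2 /andP[l1 u1] /andP[l2 u2].
  have := bound t1 x1 x2 l1 u1; have := bound t1 y1 y2 l1 u1.
  have := bound t2 y1 x2 l2 u2; have := bound t2 (- x1) y2 l2 u2.
  by rewrite sqrrN; lra.
have sumE : sqnorm2 x + sqnorm2 y = \sum_i s i by rewrite /sqnorm2 -big_split.
clearbody s.
have -> : dot x (re T *m x - im T *m y) + dot y (re T *m y + im T *m x) =
    \sum_i \sum_j (x i 0 * (re T i j * x j 0 - im T i j * y j 0) +
    y i 0 * (re T i j * y j 0 + im T i j * x j 0)).
  rewrite !dotE -big_split; apply: eq_bigr => i _.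
  rewrite big_split -!mulr_sumr sumrB big_split; congr (_ * _ + _ * _).
    by rewrite mxE [in LHS]mxE; congr (_ + _); rewrite !mxE.
  by rewrite mxE; congr (_ + _); rewrite !mxE.
apply: (@le_trans _ _ (- (a / 2) * \sum_i s i)); last first.
  rewrite -sumE mulNr lerN2; apply: le_trans (ler_wpM2l _ low).
    rewrite mulrA [a / 2 * c]mulrC ler_wpM2r ?sqnorm2_ge0//.
    by rewrite ler_pM2l.
  by rewrite ltW// divr_gt0.
apply: (@le_trans _ _ (\sum_i \sum_j
    ((if j == i then - a * s i else 0) + e * (s i + s j)))).
  by apply: ler_sum => i _; apply: ler_sum => j _; exact: entry.
have row_sum i :
    \sum_j ((if j == i then - a * s i else 0) + e * (s i + s j)) =
    - a * s i + e * (n%:R * s i + \sum_j s j).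
  rewrite big_split/= -big_mkcond/= big_pred1_eq -mulr_sumr big_split/=.
  by rewrite sumr_const card_ord mulr_natl.
under eq_bigr => i _ do rewrite row_sum.
have ss0 : 0 <= \sum_i s i by exact: sumr_ge0.
have en : e * n%:R <= a / 4.
  rewrite /e invfM mulrA mulrAC ler_pdivrMr ?ltr0n//.
  by rewrite ler_wpM2l ?ler_nat// ltW// divr_gt0.
rewrite big_split/= -mulr_sumr -[X in _ + X]mulr_sumr big_split/=.
rewrite -[X in e * (X + _)]mulr_sumr sumr_const card_ord.
rewrite -[X in e * (_ + X)]mulr_natl.
by move: en ss0; move: (\sum_i s i) n%:R => t N; nra.
Qed.

End Hurwitz.

(** * Positive definite matrices and the sup norm *)

Section PosDef.
Variable R : realType.

Lemma posdef_unit n (P : 'M[R]_n) : posdef P -> P \in unitmx.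
Proof.
move=> [symP posP]; rewrite -row_free_unit -kermx_eq0.
apply: contraT => /rowV0Pn[v vP v0].
have Pv : P *m v^T = 0.
  by rewrite -[P]symP -trmx_mul (sub_kermxP vP) trmx0.
have := posP v^T; rewrite trmx_eq0 => /(_ v0).
by rewrite -mulmxA Pv mulmx0 mxE ltxx.
Qed.

(** By the Cauchy-Schwarz inequality of the form of P, applied to v and to
    P^-1 v: |v|^4 <= (v, P v) (v, P^-1 v), where the last factor is at most a
    multiple of |v|^2. *)
Lemma posdef_coercive n (P : 'M[R]_n) : posdef P ->
  exists2 c : R, 0 < c & forall v, c * sqnorm2 v <= dot v (P *m v).
Proof.
move=> hP; have uP := posdef_unit hP; case: hP => [symP posP].
have bpos v : 0 <= dot v (P *m v).
  have [->|v0] := eqVneq v 0; first by rewrite dot0l.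
  by rewrite /dot mulmxA; exact/ltW/posP.
have bC u v : dot u (P *m v) = dot v (P *m u).
  by rewrite -[P in LHS]symP -dot_mulmxl dotC.
have [C C0 invC] := dot_mulmx_bound (invmx P).
exists (C + 1)^-1 => [|v]; first by rewrite invr_gt0 addr_gt0.
rewrite mulrC ler_pdivrMr ?addr_gt0//.
have [->|v0] := eqVneq v 0; first by rewrite sqnorm2_0 dot0l mul0r.
set b := dot v (P *m v).
have b0 : 0 < b by rewrite /b /dot mulmxA; exact: posP.
have s0 : 0 < sqnorm2 v.
  rewrite lt0r sqnorm2_ge0 andbT.
  by apply: contraNneq v0 => /sqnorm2_eq0 ->.
pose d := dot v (invmx P *m v).
have dC : d <= (C + 1) * sqnorm2 v.
  have := invC v v 1 ltr01; rewrite divr1 mul1r addrC => /(le_trans (ler_norm _)).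
  by rewrite -/d; lra.
have := bpos (b *: (invmx P *m v) - sqnorm2 v *: v).
rewrite mulmxBr -!scalemxAr mulKVmx// !dot_lin.
rewrite [dot (invmx P *m v) v]dotC -/d -/b -!sqnorm2E.
rewrite [dot (invmx P *m v) (P *m v)]bC mulKVmx// -sqnorm2E => sq.
have : sqnorm2 v * sqnorm2 v <= b * d by nra.
by move=> ?; rewrite -(ler_pM2r s0); nra.
Qed.

Lemma entry_le_norm n m (M : 'M[R]_(n, m)) i j : `|M i j| <= `|M|.
Proof.
rewrite [leRHS]mx_normrE.
exact: (@le_bigmax _ _ _ 0 (fun k => `|M k.1 k.2|) (i, j)).
Qed.

Lemma norm_le_entry n m (M : 'M[R]_(n, m)) (e : R) : 0 <= e ->
  (forall i j, `|M i j| <= e) -> `|M| <= e.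
Proof.
move=> e0 Me; rewrite [leLHS]mx_normrE.
by apply/bigmax_leP; split => // -[i j] _; exact: Me.
Qed.

Lemma norm_sqnorm2 n (v : 'cV[R]_n) : `|v| ^+ 2 <= sqnorm2 v.
Proof.
rewrite -[leRHS]sqr_sqrtr ?sqnorm2_ge0// ler_pXn2r ?nnegrE ?sqrtr_ge0//.
apply: norm_le_entry => [|i j]; first exact: sqrtr_ge0.
rewrite -sqrtr_sqr ler_wsqrtr// (ord1 j) /sqnorm2 (bigD1 i)//= lerDl.
by apply: sumr_ge0 => k _; rewrite sqr_ge0.
Qed.

Lemma sqnorm2_norm n (v : 'cV[R]_n) : sqnorm2 v <= n%:R * `|v| ^+ 2.
Proof.
have -> : n%:R * `|v| ^+ 2 = \sum_(i < n) `|v| ^+ 2.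
  by rewrite sumr_const card_ord mulr_natl.
apply: ler_sum => i _.
rewrite -real_normK ?num_real// ler_pXn2r ?nnegrE//.
exact: entry_le_norm.
Qed.

Lemma norm_mulmx n m (M : 'M[R]_(n, m)) :
  exists2 C : R, 0 < C & forall v : 'cV[R]_m, `|M *m v| <= C * `|v|.
Proof.
exists (1 + \sum_i \sum_j `|M i j|).
  by rewrite ltr_wpDr// sumr_ge0// => i _; rewrite sumr_ge0.
move=> v; apply: norm_le_entry => [|i j].
  by rewrite mulr_ge0// addr_ge0// sumr_ge0// => k _; rewrite sumr_ge0.
rewrite mxE; apply: le_trans (ler_norm_sum _ _ _) _.
apply: (@le_trans _ _ ((\sum_k `|M i k|) * `|v|)).
  rewrite mulr_suml; apply: ler_sum => k _.
  by rewrite normrM ler_wpM2l// entry_le_norm.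
rewrite ler_wpM2r// (bigD1 i)//= addrCA lerDl addr_ge0// sumr_ge0// => k _.
by rewrite sumr_ge0.
Qed.

End PosDef.

(** * Derivatives and primitives of curves in product spaces *)

Section Curves.
Variable R : realType.
Implicit Types X Y : normedModType R.

Lemma is_deriveP X (G : R -> X) (t : R) (v : X) :
  is_derive t 1 G v <->
  (fun h : R => h^-1 *: (G (h + t) - G t)) @ 0^' --> v.
Proof.
have E : (fun h : R => h^-1 *: (G (h + t) - G t)) =
         (fun h : R => h^-1 *: ((G \o shift t) (h *: (1 : R)) - G t)).
  by apply/funext => h /=; rewrite [h *: _]mulr1.
rewrite E; split=> [[dG <-] //|cG].
by apply: DeriveDef; [apply/cvg_ex; exists v | exact/cvg_lim].
Qed.

Lemma is_derive_cont X (G : R -> X) (t : R) (v : X) :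
  is_derive t 1 G v -> {for t, continuous G}.
Proof.
by move=> [/derivable1_diffP dG _]; exact: differentiable_continuous.
Qed.

Lemma is_derive_ext X (G H : R -> X) (t : R) (v : X) :
  is_derive t 1 G v -> G =1 H -> is_derive t 1 H v.
Proof. by move=> + /funext <-. Qed.

Lemma is_derive_near X (G H : R -> X) (t : R) (v : X) :
  is_derive t 1 G v -> (\forall s \near t, G s = H s) -> is_derive t 1 H v.
Proof.
move=> [dG dv] GH; apply: DeriveDef.
  by apply: near_eq_derivable dG => //; rewrite oner_neq0.
by rewrite -dv; apply/esym/near_eq_derive => //; rewrite oner_neq0.
Qed.

Lemma is_derive_cV n (G : R -> 'cV[R]_n) (t : R) (v : 'cV[R]_n) :
  is_derive t 1 G v <-> forall i, is_derive t 1 (fun s => G s i 0) (v i 0).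
Proof.
split=> [[dG <-] i|dG].
  by apply: DeriveDef; [exact: ((derivable_mxP G t 1).1 dG i 0) | rewrite derive_mx// mxE].
have dG' : derivable G t 1.
  by apply/derivable_mxP => i j; rewrite (ord1 j); case: (dG i).
apply: DeriveDef => //; rewrite derive_mx//; apply/colP => i; rewrite mxE.
by case: (dG i).
Qed.

Lemma is_derive_pair X Y (G : R -> X * Y) (t : R) (v : X * Y) :
  is_derive t 1 G v <->
  is_derive t 1 (fst \o G) v.1 /\ is_derive t 1 (snd \o G) v.2.
Proof.
case: v => v1 v2; split=> [/is_deriveP dG|[/is_deriveP d1 /is_deriveP d2]].
  split; apply/is_deriveP.
    exact: (cvg_comp _ _ dG (@cvg_fst _ _ (nbhs v1) (nbhs v2) _)).
  exact: (cvg_comp _ _ dG (@cvg_snd _ _ (nbhs v1) (nbhs v2) _)).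
by apply/is_deriveP; exact: (cvg_pair d1 d2).
Qed.

Lemma is_derive_dot n (G H : R -> 'cV[R]_n) (t : R) (v w : 'cV[R]_n) :
  is_derive t 1 G v -> is_derive t 1 H w ->
  is_derive t 1 (fun s => dot (G s) (H s)) (dot v (H t) + dot (G t) w).
Proof.
move=> /is_derive_cV dG /is_derive_cV dH.
have E : (fun s => dot (G s) (H s)) =
    \sum_(i < n) (fun s => G s i 0) * (fun s => H s i 0).
  by apply/funext => s; rewrite dotE fct_sumE.
rewrite E !dotE -big_split; apply: is_derive_eq.
by apply: eq_bigr => i _; rewrite /= addrC [X in _ + X]mulrC.
Qed.

Lemma is_derive_mulmx n m (M : 'M[R]_(n, m)) (G : R -> 'cV[R]_m) (t : R)
    (v : 'cV[R]_m) :
  is_derive t 1 G v -> is_derive t 1 (fun s => M *m G s) (M *m v).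
Proof.
move=> /is_derive_cV dG; apply/is_derive_cV => i.
have E : (fun s => (M *m G s) i 0) = \sum_(j < m) (M i j *: (fun s => G s j 0)).
  by apply/funext => s; rewrite mxE fct_sumE.
by rewrite E mxE; apply: is_derive_eq.
Qed.

Lemma is_derive_quad n (Q : 'M[R]_n) (G : R -> 'cV[R]_n) (t : R) (v : 'cV[R]_n) :
  Q^T = Q -> is_derive t 1 G v ->
  is_derive t 1 (fun s => dot (G s) (Q *m G s)) (2 * dot (G t) (Q *m v)).
Proof.
move=> symQ dG; have := is_derive_dot dG (is_derive_mulmx Q dG).
by rewrite -[in dot v _]symQ -dot_mulmxl dotC mulr_natl mulr2n.
Qed.

End Curves.

(** * Lipschitz maps *)

Section Lipschitz.
Variables (R : realType) (X : normedModType R).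

Definition lip (Y : normedModType R) (h : X -> Y) :=
  exists2 C : R, 0 < C & forall a b, `|h a - h b| <= C * `|a - b|.

Lemma lip_cst (Y : normedModType R) (y : Y) : lip (fun=> y).
Proof. by exists 1 => // a b; rewrite subrr normr0 mul1r. Qed.

Lemma lip_id : lip (id : X -> X).
Proof. by exists 1 => // a b; rewrite mul1r. Qed.

Lemma lip_add (Y : normedModType R) (h k : X -> Y) :
  lip h -> lip k -> lip (fun s => h s + k s).
Proof.
move=> [C C0 hC] [C' C'0 kC]; exists (C + C') => [|a b]; first exact: addr_gt0.
by rewrite opprD addrACA mulrDl (le_trans (ler_normD _ _))// lerD.
Qed.

Lemma lip_mulmx m n (M : 'M[R]_(m, n)) (h : X -> 'cV[R]_n) :
  lip h -> lip (fun s => M *m h s).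
Proof.
move=> [C C0 hC]; have [C' C'0 MC] := norm_mulmx M.
exists (C' * C) => [|a b]; first exact: mulr_gt0.
by rewrite -mulmxBr -mulrA (le_trans (MC _))// ler_pM2l.
Qed.

Lemma lip_fst (Y Z : normedModType R) (h : X -> Y * Z) :
  lip h -> lip (fun s => (h s).1).
Proof.
move=> [C C0 hC]; exists C => // a b; apply: le_trans (hC a b).
by rewrite [leRHS]prod_normE le_max lexx.
Qed.

Lemma lip_snd (Y Z : normedModType R) (h : X -> Y * Z) :
  lip h -> lip (fun s => (h s).2).
Proof.
move=> [C C0 hC]; exists C => // a b; apply: le_trans (hC a b).
by rewrite [leRHS]prod_normE le_max lexx orbT.
Qed.

Lemma lip_continuous (Y : normedModType R) (h : X -> Y) : lip h -> continuous h.
Proof.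
move=> [C C0 hC] a; apply/cvgrPdist_lt => e e0; near=> b.
apply: le_lt_trans (hC a b) _; rewrite mulrC -ltr_pdivlMr//.
near: b; apply: cvgr_dist_lt; first exact: cvg_id.
by rewrite divr_gt0.
Unshelve. all: by end_near. Qed.

Lemma continuous_dot n (h k : X -> 'cV[R]_n) :
  continuous h -> continuous k -> continuous (fun s => dot (h s) (k s)).
Proof.
move=> ch ck.
have -> : (fun s => dot (h s) (k s)) =
    (fun s => \sum_(i < n) h s i 0 * k s i 0) by apply/funext => s; rewrite dotE.
apply: continuous_big; first exact: add_continuous.
move=> i _ s; apply: continuousM.
  apply: (@continuous_comp _ _ _ h (fun M : 'cV[R]_n => M i 0) s (ch s)).
  exact: coord_continuous.
apply: (@continuous_comp _ _ _ k (fun M : 'cV[R]_n => M i 0) s (ck s)).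
exact: coord_continuous.
Qed.

Lemma lip_quad_upper n (h : X -> 'cV[R]_n) (Q : 'M[R]_n) : lip h ->
  exists2 C : R, 0 < C & forall a b,
    dot (h a - h b) (Q *m (h a - h b)) <= C * `|a - b| ^+ 2.
Proof.
move=> [C C0 hC]; have [CQ CQ0 boundQ] := dot_mulmx_bound Q.
exists ((1 + CQ) * (n.+1%:R * C ^+ 2)) => [|a b].
  by rewrite !mulr_gt0 ?addr_gt0 ?exprn_gt0.
set v := h a - h b.
apply: (@le_trans _ _ ((1 + CQ) * sqnorm2 v)).
  have := boundQ v v 1 ltr01; rewrite divr1 mul1r => /(le_trans (ler_norm _)).
  by rewrite mulrDl mul1r.
rewrite -mulrA ler_pM2l ?addr_gt0//; apply: le_trans (sqnorm2_norm v) _.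
rewrite -mulrA; apply: ler_pM; rewrite ?exprn_ge0 ?ler_nat//.
rewrite -exprMn ler_pXn2r ?nnegrE ?mulr_ge0 ?(ltW C0)//.
exact: hC.
Qed.

End Lipschitz.

(** * Initial value problems with a globally Lipschitz right-hand side *)

(** What the Picard iteration needs from the state space.  Each clause holds for
    the real line and passes to spaces of column vectors and to products. *)
Record curve_calculus (R : realType) (X : normedModType R) : Prop :=
  CurveCalculus {
  cc_primitive : forall g : R -> X, continuous g ->
    exists G : R -> X, forall t : R, 0 <= t -> is_derive t 1 G (g t) ;
  cc_mean_value : forall (G g : R -> X) (H h : R -> R) (t : R), 0 <= t ->
    (forall s : R, 0 <= s -> is_derive s 1 G (g s)) ->
    (forall s : R, 0 <= s -> is_derive s 1 H (h s)) ->
    (forall s, 0 <= s -> `|g s| <= h s) -> `|G t - G 0| <= H t - H 0 ;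
  cc_complete : forall (u : nat -> X) (C : R),
    (forall k, `|u k.+1 - u k| <= C * 2 ^- k) ->
    exists l : X, forall k, `|u k - l| <= 2 * C * 2 ^- k
}.

Section CurveCalculus.
Variable R : realType.

Lemma nondecreasing_of_derive (f df : R -> R) (t : R) : 0 <= t ->
  (forall s : R, 0 <= s -> is_derive s 1 f (df s)) ->
  (forall s, 0 <= s -> 0 <= df s) -> f 0 <= f t.
Proof.
move=> t0 dfE df0; have df' s : s \in `]0, t[ -> is_derive s 1 f (df s).
  by rewrite in_itv/= => /andP[s0 _]; apply: dfE; exact: ltW.
have cf : {within `[0, t], continuous f}.
  apply: continuous_in_subspaceT => s /set_mem/=; rewrite in_itv/= => /andP[s0 _].
  exact: is_derive_cont (dfE _ s0).
have [s] := MVT_segment t0 df' cf; rewrite in_itv/= => /andP[s0 _] E.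
by rewrite -subr_ge0 E subr0 mulr_ge0// df0.
Qed.

Lemma curve_calculus_real : curve_calculus (R : normedModType R).
Proof.
split=> [g cg|G g H h t t0 dG dH gh|u C uC].
(* integrating from -1 makes 0 an interior point of the interval, so that the
   derivative there is two-sided *)
- exists (fun t => (\int[@lebesgue_measure R]_(s in `[-1, t]) g s)%R) => t t0.
  have t1 : -1 < t by rewrite (lt_le_trans _ t0)// ltrN10.
  have ig : (@lebesgue_measure R).-integrable `[-1, t + 1] (EFin \o g).
    apply: continuous_compact_integrable; first exact: segment_compact.
    exact: continuous_subspaceT.
  have [] := @continuous_FTC1 R g (BLeft (-1)) t (t + 1) _ ig _ (cg t).
    by rewrite ltrDl.
    by rewrite lte_fin.
  by move=> dI IE; apply: (DeriveDef dI); rewrite -derive1E; exact: IE.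
- have down : H 0 - G 0 <= H t - G t.
    apply: (@nondecreasing_of_derive (H - G) (h - g)) => // s s0.
      have := dH _ s0; have := dG _ s0 => *; exact: is_deriveB.
    by rewrite subr_ge0 (le_trans (ler_norm _))// gh.
  have up : H 0 + G 0 <= H t + G t.
    apply: (@nondecreasing_of_derive (H + G) (h + g)) => // s s0.
      have := dH _ s0; have := dG _ s0 => *; exact: is_deriveD.
    rewrite -[g]opprK subr_ge0 (le_trans (ler_norm _))//.
    by rewrite /= normrN gh.
  by rewrite ler_norml; apply/andP; split; lra.
- have C0 : 0 <= C.
    by have := uC 0; rewrite expr0 invr1 mulr1; exact: le_trans.
  (* the intervals with centre u k and radius r k are nested *)
  pose r k : R := 2 * C * 2 ^- k.
  have rE k : r k = 2 * r k.+1 by rewrite /r exprS invfM; field; rewrite ?expf_neq0.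
  have rC k : C * 2 ^- k = r k.+1 by rewrite /r exprS invfM; field; rewrite ?expf_neq0.
  have r0 k : 0 <= r k by rewrite /r !mulr_ge0// invr_ge0 exprn_ge0.
  have lo j k : u j - r j <= u (j + k)%N - r (j + k)%N.
    elim: k => [|k IH]; first by rewrite addn0.
    rewrite addnS; apply: le_trans IH _.
    have := uC (j + k)%N; rewrite rC ler_norml => /andP[+ _].
    by rewrite (rE (j + k)%N); lra.
  have hi j k : u (j + k)%N + r (j + k)%N <= u j + r j.
    elim: k => [|k IH]; first by rewrite addn0.
    rewrite addnS; apply: le_trans _ IH.
    have := uC (j + k)%N; rewrite rC ler_norml => /andP[_].
    by rewrite (rE (j + k)%N); lra.
  have lohi j k : u j - r j <= u k + r k.
    have := lo j k; have := hi k j; rewrite addnC.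
    by have := r0 (j + k)%N; lra.
  pose A := range (fun k => u k - r k).
  have ubA k : ubound A (u k + r k) by move=> _ [j _ <-]; exact: lohi.
  exists (sup A) => k; rewrite -/(r k) ler_norml lerNl opprB.
  have -> : sup A - u k <= r k.
    rewrite lerBlDl; apply: ge_sup; last exact: ubA.
    by exists (u 0 - r 0); exists 0%N.
  rewrite lerBlDl -lerBlDr; apply: ub_le_sup; last by exists k.
  by exists (u k + r k); exact: ubA.
Qed.

Lemma curve_calculus_cV n : curve_calculus ('cV[R]_n : normedModType R).
Proof.
have cc := curve_calculus_real.
split=> [g cg|G g H h t t0 dG dH gh|u C uC].
- have /choice[G GP] : forall i : 'I_n, exists Gi : R -> R,
      forall t : R, 0 <= t -> is_derive t 1 Gi (g t i 0).
    move=> i; apply: (cc_primitive cc) => t.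
    apply: (@continuous_comp _ _ _ g (fun M : 'cV[R]_n => M i 0) t (cg t)).
    exact: coord_continuous.
  exists (fun t => \col_i G i t) => t t0; apply/is_derive_cV => i.
  by apply: is_derive_ext (GP i t t0) _ => s; rewrite mxE.
- have dh0 s : 0 <= s -> 0 <= h s by move=> /gh; exact: le_trans.
  apply: norm_le_entry => [|i j].
    by rewrite subr_ge0; exact: (nondecreasing_of_derive t0 dH dh0).
  rewrite (ord1 j) !mxE.
  apply: (cc_mean_value cc t0 (G := fun s => G s i 0) (g := fun s => g s i 0) _ dH).
    by move=> s s0; have /is_derive_cV := dG s s0; exact.
  by move=> s s0; apply: le_trans (gh s s0); exact: entry_le_norm.
- have C0 : 0 <= C.
    by have := uC 0; rewrite expr0 invr1 mulr1; exact: le_trans.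
  have /choice[l lP] : forall i : 'I_n, exists l : R,
      forall k, `|u k i 0 - l| <= 2 * C * 2 ^- k.
    move=> i; apply: (cc_complete cc) => k; apply: le_trans (uC k).
    by apply: le_trans (entry_le_norm _ i 0); rewrite !mxE.
  exists (\col_i l i) => k; apply: norm_le_entry => [|i j].
    by rewrite !mulr_ge0// invr_ge0 exprn_ge0.
  by rewrite (ord1 j) !mxE; exact: lP.
Qed.

Lemma curve_calculus_prod (X Y : normedModType R) :
  curve_calculus X -> curve_calculus Y -> curve_calculus (X * Y : normedModType R)%type.
Proof.
move=> cX cY; split=> [g cg|G g H h t t0 dG dH gh|u C uC].
- have [|G1 d1] := cc_primitive cX (g := fst \o g).
    by move=> t; apply: (@continuous_comp _ _ _ g fst t (cg t)); exact: cvg_fst.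
  have [|G2 d2] := cc_primitive cY (g := snd \o g).
    by move=> t; apply: (@continuous_comp _ _ _ g snd t (cg t)); exact: cvg_snd.
  exists (fun t => (G1 t, G2 t)) => t t0; apply/is_derive_pair; split.
    exact: d1.
  exact: d2.
- rewrite prod_normE/= ge_max; apply/andP; split.
    apply: (cc_mean_value cX t0 (G := fst \o G) (g := fst \o g) _ dH) => s s0.
      by have /is_derive_pair[] := dG s s0.
    by apply: le_trans (gh s s0); rewrite prod_normE le_max lexx.
  apply: (cc_mean_value cY t0 (G := snd \o G) (g := snd \o g) _ dH) => s s0.
    by have /is_derive_pair[] := dG s s0.
  by apply: le_trans (gh s s0); rewrite prod_normE le_max lexx orbT.
- have [|l1 L1] := cc_complete cX (u := fst \o u) (C := C).
    by move=> k; apply: le_trans (uC k); rewrite prod_normE le_max lexx.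
  have [|l2 L2] := cc_complete cY (u := snd \o u) (C := C).
    by move=> k; apply: le_trans (uC k); rewrite prod_normE le_max lexx orbT.
  by exists (l1, l2) => k; rewrite prod_normE/= ge_max L1 L2.
Qed.

End CurveCalculus.

Section Picard.
Variables (R : realType) (X : normedModType R) (cc : curve_calculus X).
Variables (F : X -> X) (L : R).
Hypotheses (L0 : 0 < L) (lipF : forall a b, `|F a - F b| <= L * `|a - b|).

(** Curves are held constant before time 0, which keeps them continuous on the
    whole line and spares one-sided continuity at 0. *)
Definition picard_step (a : X) (x y : R -> X) := exists G : R -> X,
  [/\ G 0 = a, forall t : R, 0 <= t -> is_derive t 1 G (F (x t)) &
      forall t, y t = G (Num.max 0 t)].

Lemma picard_step_exists (a : X) (x : R -> X) : continuous x ->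
  exists y, picard_step a x y.
Proof.
move=> cx; have [|G dG] := cc_primitive cc (g := F \o x).
  by move=> t; apply: (@continuous_comp _ _ _ x F t (cx t));
  by apply: lip_continuous; exists L.
exists (fun t => G (Num.max 0 t) - G 0 + a), (fun t => G t - G 0 + a); split => //.
  by rewrite subrr add0r.
move=> t t0; have := dG t t0 => ?.
by apply: is_derive_eq; rewrite subr0 addr0.
Qed.

Lemma picard_step_continuous (a : X) (x y : R -> X) :
  picard_step a x y -> continuous y.
Proof.
move=> [G [_ dG yE]] t; have -> : y = G \o Num.max 0 by apply/funext.
have m0 : 0 <= Num.max 0 t by rewrite le_max lexx.
apply: continuous_comp; last exact: is_derive_cont (dG _ m0).
by apply: continuous_max => ?; [exact: cvg_cst|exact: cvg_id].
Qed.

Let weight (t : R) := expR (2 * L * t).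

Let derive_weight (c t : R) :
  is_derive t 1 (fun s => c * weight s) (c * (2 * L) * weight t).
Proof.
rewrite /weight; apply: is_derive_eq.
by rewrite /GRing.scale/=; ring.
Qed.

Let weight_gt0 t : 0 < weight t. Proof. exact: expR_gt0. Qed.

Let weight_le s t : s <= t -> weight s <= weight t.
Proof. by move=> st; rewrite ler_expR ler_pM2l// mulr_gt0. Qed.

(** In the distance weighted by exp (2 L t) the step is a contraction with factor
    1/2, since integrating exp (2 L t) gains the factor 1 / (2 L). *)
Lemma picard_contraction (a : X) (x x' y y' : R -> X) (c : R) :
  picard_step a x y -> picard_step a x' y' ->
  (forall t, 0 <= t -> `|x t - x' t| <= 2 * c * weight t) ->
  forall t, 0 <= t -> `|y t - y' t| <= c * weight t.
Proof.
move=> [G [G0 dG yE]] [G' [G'0 dG' yE']] xx' t t0.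
rewrite yE yE' max_r//.
have c0 : 0 <= c.
  have := le_trans (normr_ge0 _) (xx' 0 (lexx _)).
  by rewrite pmulr_lge0// pmulr_rge0.
have := cc_mean_value cc (G := G - G') (g := fun s => F (x s) - F (x' s)) t0 _
  (fun s _ => derive_weight c s).
rewrite !fctE G0 G'0 subrr subr0 => /(_ _ _)/le_trans; apply.
- by move=> s s0; have := dG s s0; have := dG' s s0 => *; exact: is_deriveB.
- move=> s s0; apply: le_trans (lipF _ _) _.
  have -> : c * (2 * L) * weight s = L * (2 * c * weight s) by ring.
  by rewrite ler_pM2l//; exact: xx'.
- by rewrite gerBl mulr_ge0// ltW.
Qed.

(** The Picard iterates z k converge geometrically, uniformly on bounded intervals;
    hence their limit x is continuous, and the step y of x, being the limit of the
    z k.+1, agrees with x. *)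
Lemma picard_lindelof (a : X) : exists x : R -> X,
  [/\ continuous x, x 0 = a & forall t : R, 0 < t -> is_derive t 1 x (F (x t))].
Proof.
have /choice[Phi PhiP] : forall x : {x : R -> X | continuous x},
    exists y : {x : R -> X | continuous x}, picard_step a (sval x) (sval y).
  move=> [x cx]; have [y xy] := picard_step_exists a cx.
  by exists (exist _ y (picard_step_continuous xy)).
have ca : continuous (fun _ : R => a) by move=> ?; exact: cvg_cst.
pose z k := sval (iter k Phi (exist _ _ ca)).
have zS k : picard_step a (z k) (z k.+1) by exact: PhiP.
have cz k : continuous (z k).
  by case: k => [//|k]; exact: picard_step_continuous (zS k).
have zmax k t : z k (Num.max 0 t) = z k t.
  case: k => [//|k]; have [G [_ _ zE]] := zS k.
  by rewrite !zE maxA maxxx.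
(* the first step moves the constant curve by at most M times the weight *)
pose M := `|F a| / (2 * L).
have M0 : 0 <= M by rewrite divr_ge0// mulr_ge0// ltW.
have zz k t : 0 <= t -> `|z k.+1 t - z k t| <= M * 2 ^- k * weight t.
  elim: k t => [|k IH] t t0.
    have [G [G0 dG zE]] := zS 0%N.
    rewrite zE max_r// -[z 0%N t]G0 expr0 invr1 mulr1.
    apply: le_trans (cc_mean_value cc t0 dG (fun s _ => derive_weight M s) _) _.
      move=> s s0; rewrite /M divfK ?gt_eqF ?mulr_gt0//.
      by rewrite ler_peMr// -expR0 ler_expR mulr_ge0// mulr_ge0// ltW.
    by rewrite gerBl mulr_ge0// ltW.
  apply: (picard_contraction (zS k.+1) (zS k)) => // s s0.
  apply: le_trans (IH _ s0) _; rewrite ler_pM2r//.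
  have -> : 2 * (M / 2 ^+ k.+1) = M / 2 ^+ k.
    by rewrite exprS invfM; field; rewrite ?expf_neq0.
  by [].
have /choice[x xP] : forall t, exists l, forall k,
    `|z k t - l| <= 2 * (M * weight (Num.max 0 t)) * 2 ^- k.
  move=> t; apply: (cc_complete cc) => k; rewrite -zmax -(zmax k) mulrAC.
  by apply: zz; rewrite le_max lexx.
have tail (K e : R) : 0 < e -> \forall k \near \oo, K * 2 ^- k < e.
  move=> e0; have [K0|K0] := leP K 0.
    near=> k; apply: le_lt_trans e0; rewrite pmulr_lle0//.
  have : (fun k => K * 2 ^- k) @ \oo --> (0 : R).
    rewrite -(mulr0 K); apply: (cvgM (cvg_cst K)).
    under eq_fun do rewrite -exprVn.
    by apply: cvg_expr; rewrite ger0_norm ?invr_ge0// invf_lt1// ltr1n.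
  move=> /cvgr0Pnorm_lt/(_ e e0); apply: filterS => k.
  exact: le_lt_trans (ler_norm _).
have cx : continuous x.
  move=> t; apply/cvgrPdist_lt => e e0.
  set W := weight (Num.max 0 (t + 1)).
  have e3 : 0 < e / 3 by rewrite divr_gt0.
  have [k _ /(_ k (leqnn _)) ke] := tail (2 * (M * W)) _ e3.
  have close s : s <= t + 1 -> `|z k s - x s| < e / 3.
    move=> st; apply: le_lt_trans ke; apply: le_trans (xP s k) _.
    rewrite ler_pM2r ?invr_gt0 ?exprn_gt0// ler_pM2l// ler_wpM2l// weight_le//.
    by rewrite ge_max !le_max lexx st orbT.
  have near_le : \forall s \near t, s <= t + 1.
    apply: filterS (nbhsx_ballx t 1 ltr01) => s.
    by rewrite -ball_normE/= ltr_distlC => /andP[_ /ltW].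
  near=> s; have st : s <= t + 1 by near: s.
  have -> : x t - x s = (z k t - z k s) - (z k t - x t) + (z k s - x s).
    by rewrite opprB (addrC (z k t - z k s)) !subrKA.
  apply: le_lt_trans (ler_normD _ _) _.
  have -> : e = e / 3 + e / 3 + e / 3 by field.
  apply: ltrD; last exact: close.
  apply: le_lt_trans (ler_normB _ _) _.
  apply: ltrD; last by apply: close; rewrite lerDl.
  near: s; move/cvgrPdist_lt : (cz k t); exact.
have [y xy] := picard_step_exists a cx; have [G [G0 dG yE]] := xy.
have yx t : 0 <= t -> y t = x t.
  move=> t0; apply/eqP; rewrite -subr_eq0 -normr_le0.
  apply/ler_addgt0Pr => e e0; rewrite add0r.
  have [k _ /(_ k (leqnn _)) ke] := tail (2 * (M * weight t)) _ e0.
  apply: ltW; apply: le_lt_trans ke.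
  have yz : `|z k.+1 t - y t| <= M * 2 ^- k * weight t.
    apply: (picard_contraction (zS k) xy) => // s s0.
    by have := xP s k; rewrite max_r// => /le_trans; apply; rewrite !mulrA mulrAC.
  have := xP t k.+1; rewrite max_r// exprS invfM => zx.
  have -> : y t - x t = (z k.+1 t - x t) - (z k.+1 t - y t).
    by rewrite opprB (addrC (z k.+1 t - x t)) subrKA.
  apply: le_trans (ler_normB _ _) _.
  apply: le_trans (lerD zx yz) _.
  rewrite le_eqVlt; apply/orP; left; apply/eqP.
  by field; rewrite expf_neq0.
exists x; split => //; first by rewrite -yx// yE max_r.
move=> t t0; apply: is_derive_near (dG t (ltW t0)) _.
apply: filterS (nbhsx_ballx t t t0) => s.
rewrite -ball_normE/= ltr_distlC subrr => /andP[s0 _].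
by rewrite -yx ?ltW// yE max_r// ltW.
Unshelve. all: by end_near. Qed.

End Picard.

(** * Exponential stability from a quadratic Lyapunov function *)

Section Retraction.
Variables (R : realType) (X : normedModType R) (r : R).
Hypothesis r0 : 0 < r.

(** The radial projection onto the ball of radius r.  Precomposing with it makes a
    map that is Lipschitz on this ball globally Lipschitz. *)
Definition retract (v : X) : X := (r / Num.max r `|v|) *: v.

Let max_gt0 v : 0 < Num.max r `|v : X|. Proof. by rewrite lt_max r0. Qed.

Lemma retract_id v : `|v| <= r -> retract v = v.
Proof. by move=> vr; rewrite /retract max_l// divff ?gt_eqF// scale1r. Qed.

Lemma retract_le v : `|retract v| <= r.
Proof.
rewrite /retract normrZ gtr0_norm ?divr_gt0// mulrAC ler_pdivrMr//.
by rewrite ler_pM2l// le_max lexx orbT.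
Qed.

Lemma retract_lipschitz v w : `|retract v - retract w| <= 2 * `|v - w|.
Proof.
rewrite /retract; set M := Num.max r `|v|; set N := Num.max r `|w|.
have M0 : 0 < M := max_gt0 v; have N0 : 0 < N := max_gt0 w.
have -> : (r / M) *: v - (r / N) *: w =
    (r / M) *: (v - w) + (r / M * ((N - M) / N)) *: w.
  rewrite scalerBr -(scaleNr (r / N)) -(scaleNr (r / M)) -addrA -scalerDl.
  by congr (_ + _ *: _); field; rewrite !gt_eqF.
have rM : r / M <= 1 by rewrite ler_pdivrMr// mul1r le_max lexx.
have rM0 : 0 <= r / M by rewrite divr_ge0 ?ltW.
have wN : `|w| / N <= 1 by rewrite ler_pdivrMr// mul1r le_max lexx orbT.
have NM : `|N - M| <= `|v - w|.
  have vw : `|w| <= `|v| + `|v - w| by rewrite -lerBlDl distrC; exact: lerB_dist.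
  have wv : `|v| <= `|w| + `|v - w| by rewrite -lerBlDl; exact: lerB_dist.
  rewrite ler_norml; apply/andP; rewrite /M /N; move: vw wv (normr_ge0 (v - w)).
  by split; case: (lerP r `|v|); case: (lerP r `|w|) => *; lra.
apply: le_trans (ler_normD _ _) _; rewrite mulr_natl mulr2n lerD//.
  by rewrite normrZ ger0_norm// ler_piMl.
rewrite normrZ normrM (ger0_norm rM0) normrM normfV (gtr0_norm N0).
rewrite -(mulrA (r / M)); apply: le_trans (ler_piMl _ rM) _.
  by rewrite !mulr_ge0// invr_ge0 ltW.
by apply: le_trans NM; rewrite -mulrA [N^-1 * _]mulrC ler_piMr.
Qed.

End Retraction.

Section Stability.
Variables (R : realType) (X : normedModType R) (cc : curve_calculus X).

Lemma nonincreasing_of_derive (f : R -> R) (t : R) : 0 <= t ->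
  {within `[0, t], continuous f} ->
  (forall s : R, 0 < s -> s < t -> exists2 d, d <= 0 & is_derive s 1 f d) ->
  f t <= f 0.
Proof.
move=> t0 cf df.
have df' s : s \in `]0, t[ -> is_derive s 1 f ('D_1 f s).
  rewrite in_itv/= => /andP[s0 st]; have [d _ [fd dE]] := df s s0 st.
  by apply: DeriveDef.
rewrite -subr_le0; move: t0; rewrite le_eqVlt => /predU1P[<-|t0].
  by rewrite subrr.
have [s + ->] := MVT t0 df' cf; rewrite in_itv/= => /andP[s0 st].
have [d d0 [_ ->]] := df s s0 st.
by rewrite subr0 pmulr_lle0.
Qed.

Variables (dom : set X) (F : X -> X) (p : X) (V : X -> R).
Variables (r al be lam L : R).
Hypotheses (r0 : 0 < r) (al0 : 0 < al) (be0 : 0 < be) (lam0 : 0 < lam).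
Hypothesis L0 : 0 < L.
Hypothesis dom_ball : forall s, `|s - p| <= r -> dom s.
Hypothesis lipF : forall a b, `|a - p| <= r -> `|b - p| <= r ->
  `|F a - F b| <= L * `|a - b|.
Hypothesis contV : continuous V.
Hypothesis lowV : forall s, al * `|s - p| ^+ 2 <= V s.
Hypothesis upV : forall s, V s <= be * `|s - p| ^+ 2.
Hypothesis decV : forall (x : R -> X) (t : R), `|x t - p| <= r ->
  is_derive t 1 x (F (x t)) ->
  exists2 d, d <= - (2 * lam * V (x t)) & is_derive t 1 (V \o x) d.

(* points within distance del of p lie strictly below the level al * r ^+ 2 of V *)
Let del := r * Num.min 1 (al / be) / 2.

Let del0 : 0 < del.
Proof. by rewrite /del divr_gt0// mulr_gt0// lt_min ltr01 divr_gt0. Qed.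

Let del_level s : `|s - p| < del -> V s < al * r ^+ 2.
Proof.
move=> sd; apply: le_lt_trans (upV s) _.
pose k := Num.min 1 (al / be); have delE : del = r * k / 2 by [].
have k0 : 0 < k by rewrite lt_min ltr01 divr_gt0.
have k1 : k <= 1 by rewrite ge_min lexx.
have kb : k * be <= al by rewrite -ler_pdivlMr// ge_min lexx orbT.
have : `|s - p| ^+ 2 <= del ^+ 2 by rewrite ler_pXn2r ?nnegrE ?(ltW del0) ?(ltW sd).
rewrite -(ler_pM2l be0) => /le_lt_trans; apply.
have -> : be * del ^+ 2 = (k * be) * k * r ^+ 2 / 4 by rewrite delE; field.
have r2 : 0 < r ^+ 2 by rewrite exprn_gt0.
have : k * be * k <= al.
  by apply: le_trans kb; rewrite ler_piMr// mulr_ge0// ltW.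
have : 0 < k * be * k by rewrite !mulr_gt0.
by move: (k * be * k) (r ^+ 2) r2 => a b *; nra.
Qed.

(** A trajectory cannot reach the level al * r^2: at the first such time V would
    have to be larger than at time 0, although V decreases as long as the
    trajectory stays within distance r of p.  The field G has to agree with F only
    there, so the lemma also applies to a modification of F away from p. *)
Lemma lyapunov_decay (G : X -> X) (b : \bar R) (x : R -> X) :
  (forall s, `|s - p| <= r -> G s = F s) -> (0 < b)%E ->
  {within [set t : R | 0 <= t /\ (t%:E < b)%E], continuous x} ->
  (forall t : R, 0 < t -> (t%:E < b)%E -> is_derive t 1 x (G (x t))) ->
  `|x 0 - p| < del ->
  forall t : R, 0 <= t -> (t%:E < b)%E ->
    `|x t - p| <= r /\ V (x t) <= expR (- (2 * lam * t)) * V (x 0).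
Proof.
move=> GF b0 cx dx x0 t t0 tb.
pose A : set R := [set t : R | 0 <= t /\ (t%:E < b)%E].
have A_le s u : 0 <= s -> s <= u -> (u%:E < b)%E -> A s.
  by move=> s0 su ub; split=> //; apply: le_lt_trans ub; rewrite lee_fin.
have cV : {within A, continuous (V \o x)}.
  apply/subspace_continuousP => s As.
  have cxs : x @ within A (nbhs s) --> x s.
    by have /subspace_continuousP/(_ s As) := cx.
  have c : (V \o x) @ within A (nbhs s) --> V (x s).
    by apply: cvg_comp cxs _; exact: contV.
  by [].
have itvA u : 0 <= u -> (u%:E < b)%E -> `[0, u]%classic `<=` A.
  by move=> u0 ub s /=; rewrite in_itv/= => /andP[s0 su]; exact: A_le ub.
have le_r s : V s < al * r ^+ 2 -> `|s - p| <= r.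
  move=> /(le_lt_trans (lowV s)); rewrite ltr_pM2l// => /ltW.
  by rewrite ler_pXn2r// nnegrE// ltW.
have dV s : 0 < s -> (s%:E < b)%E -> `|x s - p| <= r ->
    exists2 d, d <= - (2 * lam * V (x s)) & is_derive s 1 (V \o x) d.
  by move=> s0 sb xr; apply: decV => //; rewrite -GF//; exact: dx.
have V0 s : 0 <= V s.
  by apply: le_trans (lowV s); rewrite mulr_ge0 ?exprn_ge0// ltW.
have below u : 0 <= u -> (u%:E < b)%E -> V (x u) < al * r ^+ 2.
  move=> u0 ub; rewrite ltNge; apply/negP => Vu.
  pose E := [set s | [/\ 0 <= s, s <= u & al * r ^+ 2 <= V (x s)]].
  have Eu : E u by split.
  have hE : has_inf E by split; [exists u | exists 0 => s []].
  have t10 : 0 <= inf E by apply: lb_le_inf => [|s []]; first by exists u.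
  have t1u : inf E <= u by apply: ge_inf => //; exists 0 => s [].
  have t1b : ((inf E)%:E < b)%E by apply: le_lt_trans ub; rewrite lee_fin.
  have before s : 0 <= s -> s < inf E -> V (x s) < al * r ^+ 2.
    move=> s0 st; rewrite ltNge; apply/negP => Vs.
    have : inf E <= s.
      apply: ge_inf; first by exists 0 => ? [].
      by split => //; apply: le_trans t1u; exact: ltW.
    by rewrite leNgt st.
  have Vt1 : al * r ^+ 2 <= V (x (inf E)).
    rewrite leNgt; apply/negP => lt1.
    have e0 : 0 < al * r ^+ 2 - V (x (inf E)) by rewrite subr_gt0.
    have At1 : A (inf E) by split.
    have /subspace_continuousP/(_ _ At1)/cvgrPdist_lt/(_ _ e0) := cV.
    rewrite near_withinE => /nbhs_ballP[d /= d0 dP].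
    have [s [s0 su Vs] sd] := inf_adherent d0 hE.
    have ts : inf E <= s by apply: ge_inf; [exists 0 => ? []|split].
    have := dP s; rewrite -ball_normE/= ltr_distlC => /(_ _ _).
    have -> : inf E - d < s < inf E + d.
      by rewrite sd andbT; apply: lt_le_trans ts; rewrite gtrBl.
    move=> /(_ isT (A_le s u s0 su ub)); rewrite ltr_distlC => /andP[_].
    by rewrite addrC subrK ltNge Vs.
  have : V (x (inf E)) <= V (x 0).
    apply: (@nonincreasing_of_derive (V \o x)) => //.
      by apply: continuous_subspaceW cV; exact: itvA.
    move=> s s0 st.
    have sb : (s%:E < b)%E by apply: lt_trans t1b; rewrite lte_fin.
    have [d dle dd] := dV s s0 sb (le_r _ (before s (ltW s0) st)).
    exists d => //; apply: le_trans dle _.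
    by rewrite oppr_le0 mulr_ge0// mulr_ge0// ltW.
  by rewrite leNgt (lt_le_trans (del_level x0) Vt1).
split; first by apply: le_r; exact: below.
have : expR (2 * lam * t) * V (x t) <= expR (2 * lam * 0) * V (x 0).
  pose f := fun s => expR (2 * lam * s) * V (x s).
  rewrite -/(f t) -/(f 0); apply: nonincreasing_of_derive => //.
    apply: (@continuous_subspaceW _ _ _ A); first exact: itvA.
    apply/subspace_continuousP => s As.
    have Vs : (V \o x) @ within A (nbhs s) --> V (x s).
      by have /subspace_continuousP/(_ s As) := cV.
    have Es : (fun u => expR (2 * lam * u)) @ within A (nbhs s) -->
        expR (2 * lam * s).
      have /subspace_continuousP/(_ s As) // :
        {within A, continuous (fun u => expR (2 * lam * u))}.
      apply: continuous_subspaceT => u.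
      apply: continuous_comp; last exact: continuous_expR.
      by apply: continuousM; [exact: cvg_cst|exact: cvg_id].
    have Ps : f @ within A (nbhs s) --> f s by exact: cvgM Es Vs.
    by [].
  move=> s s0 st.
  have sb : (s%:E < b)%E by apply: lt_trans tb; rewrite lte_fin.
  have [d dle dd] := dV s s0 sb (le_r _ (below s (ltW s0) sb)).
  exists (expR (2 * lam * s) * d + V (x s) * (2 * lam * expR (2 * lam * s))).
    have -> : expR (2 * lam * s) * d + V (x s) * (2 * lam * expR (2 * lam * s)) =
      expR (2 * lam * s) * (d + 2 * lam * V (x s)) by ring.
    by rewrite pmulr_rle0 ?expR_gt0//; lra.
  rewrite /f; apply: is_derive_eq; rewrite /GRing.scale/=; ring.
rewrite mulr0 expR0 mul1r => Vle.
by rewrite expRN [_^-1 * _]mulrC ler_pdivlMr ?expR_gt0// mulrC.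
Qed.

(** Trajectories are obtained for a globally Lipschitz modification of F; by
    lyapunov_decay they stay where it agrees with F. *)
Lemma lyapunov_exp_stable : locally_exp_stable dom F p.
Proof.
exists del, (Num.sqrt (be / al)), lam; split=> //.
  by rewrite sqrtr_gt0 divr_gt0.
move=> p0 p0d; split; last first.
  move=> b x b0 [cx _ dx] x0 t t0 tb.
  have [] := lyapunov_decay (fun s _ => erefl) b0 cx dx _ t0 tb; first by rewrite x0.
  move=> _ Vle; rewrite -ler_sqr ?nnegrE ?mulr_ge0 ?expR_ge0 ?sqrtr_ge0//.
  rewrite !exprMn sqr_sqrtr ?divr_ge0 ?(ltW be0) ?(ltW al0)// -(ler_pM2l al0).
  apply: le_trans (lowV _) _; apply: le_trans Vle _.
  have -> : expR (- (lam * t)) ^+ 2 = expR (- (2 * lam * t)).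
    by rewrite -expRM_natl -mulrN; congr expR; rewrite mulrA mulrN.
  have -> : al * (be / al * expR (- (2 * lam * t)) * `|p0 - p| ^+ 2) =
      expR (- (2 * lam * t)) * (be * `|p0 - p| ^+ 2) by field; rewrite gt_eqF.
  by rewrite ler_pM2l ?expR_gt0// x0; exact: upV.
pose G s := F (p + retract r (s - p)).
have GF s : `|s - p| <= r -> G s = F s.
  by move=> sr; rewrite /G retract_id// addrC subrK.
have lipG a b : `|G a - G b| <= (L * 2) * `|a - b|.
  apply: le_trans (lipF _ _) _; rewrite ?(addrC p) ?addrK ?retract_le//.
  rewrite -mulrA ler_pM2l// opprD addrACA subrr addr0.
  apply: le_trans (retract_lipschitz r0 _ _) _.
  by rewrite opprB addrA subrK.
have [|x [cx x0 dx]] := picard_lindelof cc _ lipG p0; first by rewrite mulr_gt0.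
have cxA : {within [set t : R | 0 <= t /\ (t%:E < +oo)%E], continuous x}.
  exact: continuous_subspaceT.
have xr t : 0 <= t -> `|x t - p| <= r.
  move=> t0; have [] // := lyapunov_decay GF (ltry 0) cxA _ _ t0 (ltry t).
    by move=> s s0 _; exact: dx.
  by rewrite x0.
exists x => //; split => // t t0 _.
  by apply: dom_ball; exact: xr.
by rewrite -GF; [exact: dx | apply: xr; exact: ltW].
Qed.

End Stability.

(** * Convex cost functions and their gradients *)

Lemma dot_norm (R : realType) n (u v : 'cV[R]_n) :
  `|dot u v| <= n%:R * `|u| * `|v|.
Proof.
have -> : n%:R * `|u| * `|v| = \sum_(i < n) `|u| * `|v|.
  by rewrite sumr_const card_ord -[RHS]mulr_natl mulrA.
rewrite dotE; apply: le_trans (ler_norm_sum _ _ _) _; apply: ler_sum => i _.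
by rewrite normrM ler_pM// entry_le_norm.
Qed.

(** Radius and constant are explicit: over the exogenous signals the constant will
    be uniform, while the radius may vary. *)
Definition smooth_ball (R : realType) n (X : set 'cV[R]_n)
    (f : 'cV[R]_n -> \bar R) (x : 'cV[R]_n) (r L : R) :=
  (forall a, `|a - x| <= r -> X° a) /\
  forall a b, `|a - x| <= r -> `|b - x| <= r ->
    `|gradient f a - gradient f b| <= L * `|a - b|.

Lemma smooth_ballW (R : realType) n (X : set 'cV[R]_n) (f : 'cV[R]_n -> \bar R)
    x y (r r' L L' : R) :
  `|y - x| + r' <= r -> L <= L' -> smooth_ball X f x r L ->
  smooth_ball X f y r' L'.
Proof.
move=> yr LL' [Xr lip].
have inr a : `|a - y| <= r' -> `|a - x| <= r.
  move=> ay; rewrite -(subrKA y); apply: le_trans (ler_normD _ _) _.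
  by rewrite addrC; apply: le_trans yr; rewrite lerD2l.
split=> [a /inr/Xr//|a b /inr ar /inr br].
by apply: le_trans (lip _ _ ar br) _; rewrite ler_wpM2r.
Qed.

Section ConvexCost.
Variables (R : realType) (n : nat) (X : set 'cV[R]_n) (f : 'cV[R]_n -> \bar R).
Hypothesis hf : convex_cost X f.

Lemma derive_gradient x v : X° x ->
  'D_v (fine \o f) x = dot (gradient f x) v.
Proof.
move=> Xx; have df := cost_diff hf Xx; rewrite deriveE//.
have -> : v = \sum_i v i 0 *: delta_mx i 0.
  by rewrite [LHS]matrix_sum_delta; apply: eq_bigr => i _; rewrite big_ord1.
rewrite linear_sum dotE; apply: eq_bigr => i _.
rewrite linearZ mxE deriveE// summxE (bigD1 i)//= big1 ?addr0.
  by rewrite !mxE !eqxx mulr1 mulrC.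
by move=> j ji; rewrite !mxE eq_sym (negbTE ji) mulr0.
Qed.

Lemma gradient_ineq x y : X° x -> f y \is a fin_num ->
  fine (f x) + dot (gradient f x) (y - x) <= fine (f y).
Proof.
move=> Xx fy.
have Xy : X y by apply: contrapT => /(cost_out hf) fyE; rewrite fyE in fy.
have Xx' : X x by exact: interior_subset Xx.
rewrite -derive_gradient// leNgt; apply/negP; rewrite -ltrBlDl => lt.
set D := 'D_(y - x) _ _ in lt; set C := fine (f y) - fine (f x) in lt.
have /cvgrPdist_lt/(_ (D - C)) : (fun h : R => h^-1 *:
    ((fine \o f) (h *: (y - x) + x) - (fine \o f) x)) @ 0^' --> D.
  by have := @diff_derivable _ _ _ _ _ (y - x) (cost_diff hf Xx).
rewrite subr_gt0 => /(_ lt) [d /= d0 dP].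
pose t := Num.min (d / 2) (1 / 2).
have t0 : 0 < t by rewrite lt_min !divr_gt0.
have t1 : t < 1 by rewrite gt_min; apply/orP; right; lra.
have td : t < d by rewrite gt_min; apply/orP; left; lra.
have := dP t; rewrite /= sub0r normrN gtr0_norm// gt_eqF// => /(_ td isT).
have := cost_convex hf Xy Xx' t0 t1.
have -> : t *: y + (1 - t) *: x = t *: (y - x) + x.
  by rewrite scalerBl scalerBr scale1r addrA addrAC.
set z := t *: (y - x) + x.
rewrite -{1}(fineK fy) -{1}(fineK (cost_fin hf Xx)) -!EFinM -EFinD => fz_le.
have fz : f z \is a fin_num.
  by rewrite fin_numE (cost_notNy hf)/= -ltey (le_lt_trans fz_le)// ltry.
move: fz_le; rewrite -(fineK fz) lee_fin => fz_le.
suff : t^-1 * (fine (f z) - fine (f x)) <= C.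
  by rewrite ltr_distlC => q /andP[]; rewrite opprB addrC subrK => /(le_lt_trans q); rewrite ltxx.
by rewrite mulrC ler_pdivrMr// /C; lra.
Qed.

Lemma smooth_ball_exists x : X° x -> exists r L : R,
  [/\ 0 < r, 0 < L & smooth_ball X f x r L].
Proof.
move=> Xx.
have := @cost_grad_lip _ _ _ _ hf (x, x) (conj Xx Xx).
rewrite /lipschitz_on => lipM.
have [L [L0]] : exists L : R, 0 < L /\
    L.-lipschitz_on (gradient f) (within (X° `*` X°) (nbhs (x, x))).
  near (+oo : set_system R) => L; exists L; split; last by near: L.
  by near: L; exact: nbhs_pinfty_gt.
rewrite /dominated_by/= => /nbhs_ballP[r1 /= r10 lip].
have /nbhs_ballP[r2 /= r20 Xr] : nbhs x X° by exact: nbhs_interior.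
pose r := Num.min r1 r2 / 2.
have r0 : 0 < r by rewrite divr_gt0// lt_min r10.
have [rr1 rr2] : r < r1 /\ r < r2.
  by rewrite /r; case: (leP r1 r2) => ?; split; lra.
have Xball a : `|a - x| <= r -> X° a.
  move=> ax; apply: Xr; rewrite -ball_normE/= distrC; exact: le_lt_trans rr2.
exists r, L; split => //; split => // a b ax bx.
apply: (lip (a, b)); last by split; exact: Xball.
by split; rewrite -ball_normE/= distrC; apply: le_lt_trans rr1.
Unshelve. all: by end_near. Qed.

(** The function z |-> f z - (grad f a, z) is minimal at a; comparing its value at
    a with the one after a gradient step from b bounds |g|^2 by the Bregman
    distance of a and b.  The last hypothesis says that the gradient changes by at
    most |g| / 2 along the step. *)
Lemma bregman_lower (a b : 'cV[R]_n) (s : R) :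
  let g := gradient f b - gradient f a in
  let z := b - s *: g in
  0 <= s -> X° a -> X° b -> X° z ->
  4 * sqnorm2 (gradient f z - gradient f b) <= sqnorm2 g ->
  s * sqnorm2 g <= 2 * (fine (f b) - fine (f a) - dot (gradient f a) (b - a)).
Proof.
move=> g z s0 Xa Xb Xz small.
have := gradient_ineq Xa (cost_fin hf Xz).
have := gradient_ineq Xz (cost_fin hf Xb).
have -> : b - z = s *: g by rewrite /z opprB addrC subrK.
have -> : z - a = (b - a) - s *: g by rewrite /z addrAC.
have -> : gradient f z = (gradient f z - gradient f b) + gradient f a + g.
  by rewrite /g -addrA (addrC (gradient f a)) subrK subrK.
move: small; set e := gradient f z - gradient f b => small.
clearbody e; clearbody z; clearbody g; move: (b - a) => d.
have two0 : 0 < 2 :> R by [].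
have := young (- e) g two0.
rewrite !dot_lin sqnorm2N -!sqnorm2E => eg ineq1 ineq2.
have : s * (2 * - dot e g) <= s * sqnorm2 g.
  by apply: ler_wpM2l => //; lra.
by lra.
Qed.

(** The sum of the Bregman distances of (x, y) and of (y, x) is the inner product
    on the right.  Points within r / 2 of x leave room in the ball for the gradient
    step; the dimension enters since the Lipschitz condition is in the sup norm. *)
Lemma cocoercive (x y : 'cV[R]_n) (r L : R) : 0 < L ->
  smooth_ball X f x r L -> `|y - x| <= r / 2 ->
  sqnorm2 (gradient f y - gradient f x) <=
    2 * n.+1%:R * L * dot (gradient f y - gradient f x) (y - x).
Proof.
move=> L0 [Xr lip] yr.
have r0 : 0 <= r by have := le_trans (normr_ge0 _) yr; lra.
set s := (2 * n.+1%:R * L)^-1.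
have n0 : 0 < n.+1%:R :> R by rewrite ltr0n.
have sL : s * L = (2 * n.+1%:R)^-1.
  by rewrite /s invfM -mulrA mulVf ?mulr1// gt_eqF.
have s0 : 0 < s by rewrite invr_gt0 !mulr_gt0.
have sL2 : s * L <= 1 / 2.
  by rewrite sL invfM div1r ler_piMr// invf_le1// ler1n.
have step a b : `|a - x| <= r / 2 -> `|b - x| <= r / 2 ->
    `|a - b| <= r / 2 ->
    s * sqnorm2 (gradient f b - gradient f a) <=
    2 * (fine (f b) - fine (f a) - dot (gradient f a) (b - a)).
  move=> ar br abr; set g := gradient f b - gradient f a.
  have half c : `|c - x| <= r / 2 -> `|c - x| <= r by lra.
  have zb : `|s *: g| <= r / 2.
    rewrite normrZ gtr0_norm//.
    apply: le_trans (ler_wpM2l (ltW s0) (lip _ _ (half _ br) (half _ ar))) _.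
    rewrite mulrA distrC; apply: le_trans abr.
    by rewrite ler_piMl//; lra.
  have zr : `|b - s *: g - x| <= r.
    by rewrite addrAC; apply: le_trans (ler_normB _ _) _; lra.
  apply: bregman_lower (ltW s0) (Xr _ (half _ ar)) (Xr _ (half _ br)) (Xr _ zr) _.
  apply: le_trans (ler_wpM2l _ (sqnorm2_norm _)) _ => //.
  have := lip _ _ zr (half _ br).
  rewrite addrAC subrr add0r normrN normrZ gtr0_norm// mulrA (mulrC L) sL => eg.
  have : `|gradient f (b - s *: g) - gradient f b| ^+ 2 <=
      ((2 * n.+1%:R)^-1 * `|g|) ^+ 2.
    by rewrite ler_pXn2r ?nnegrE// mulr_ge0// invr_ge0 mulr_ge0// ltW.
  move=> /(ler_wpM2l (ler0n R n)) nE; apply: le_trans (norm_sqnorm2 g).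
  apply: le_trans (ler_wpM2l _ nE) _ => //.
  have -> : 4 * (n%:R * ((2 * n.+1%:R)^-1 * `|g|) ^+ 2) =
      n%:R / n.+1%:R * n.+1%:R^-1 * `|g| ^+ 2 by field; rewrite gt_eqF.
  rewrite ler_piMl ?exprn_ge0//.
  rewrite -[leRHS](mulr1 1); apply: ler_pM; rewrite ?divr_ge0 ?invr_ge0 ?ler0n//.
    by rewrite ler_pdivrMr// mul1r ler_nat.
  by rewrite invf_le1// ler1n.
have xr : `|x - x| <= r / 2 by rewrite subrr normr0; lra.
have xy : `|x - y| <= r / 2 by rewrite distrC.
have := step x y xr yr xy; have := step y x yr xr yr.
rewrite -(opprB (gradient f y)) sqnorm2N -(opprB y x) !dot_lin => up down.
have -> : 2 * n.+1%:R * L = s^-1 by rewrite invrK.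
by rewrite mulrC ler_pdivlMr// mulrC; lra.
Qed.

Lemma smooth_ball_lipschitz (x : 'cV[R]_n) (r L : R) : 0 < r -> 0 < L ->
  smooth_ball X f x r L -> exists2 G : R, 0 < G &
  forall a b, `|a - x| <= r -> `|b - x| <= r ->
    `|fine (f a) - fine (f b)| <= G * `|a - b|.
Proof.
move=> r0 L0 [Xr lip].
pose G := n%:R * (`|gradient f x| + L * r) + 1.
have G0 : 0 < G.
  by rewrite ltr_wpDl// mulr_ge0// addr_ge0// mulr_ge0// ltW.
have half a b : `|a - x| <= r -> `|b - x| <= r ->
    fine (f a) - fine (f b) <= G * `|a - b|.
  move=> ar br.
  have := gradient_ineq (Xr _ ar) (cost_fin hf (Xr _ br)).
  have := dot_norm (gradient f a) (b - a).
  rewrite distrC ler_norml => /andP[low _] ineq.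
  have ga : `|gradient f a| <= `|gradient f x| + L * r.
    rewrite -[gradient f a](subrK (gradient f x)) addrC.
    apply: le_trans (ler_normD _ _) _; rewrite lerD2l.
    apply: le_trans (lip _ _ ar _) _; first by rewrite subrr normr0 ltW.
    by rewrite ler_pM2l.
  have : n%:R * `|gradient f a| * `|a - b| <= G * `|a - b|.
    by rewrite ler_wpM2r// /G ler_wpDr// ler_wpM2l.
  by lra.
exists G => // a b ar br; rewrite ler_norml; apply/andP; split; last exact: half.
by have := half b a br ar; rewrite distrC; lra.
Qed.

(** The gradient inequality at the far end point, whose gradient differs from the
    one at x by at most L t |v|. *)
Lemma cost_increment (x v : 'cV[R]_n) (r L t : R) : 0 < t -> 0 < L ->
  smooth_ball X f x r L -> t * `|v| <= r ->
  fine (f (x + t *: v)) - fine (f x) <=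
  t * (dot (gradient f x) v + n%:R * L * `|v| ^+ 2 * t).
Proof.
move=> t0 L0 [Xr lip] tv; set x' := x + t *: v.
have xr : `|x - x| <= r.
  by rewrite subrr normr0; apply: le_trans tv; rewrite mulr_ge0// ltW.
have xx' : `|x' - x| = t * `|v| by rewrite addrC addKr normrZ gtr0_norm.
have x'r : `|x' - x| <= r by rewrite xx'.
have := gradient_ineq (Xr _ x'r) (cost_fin hf (Xr _ xr)).
have -> : x - x' = - (t *: v) by rewrite opprD addNKr.
have := dot_norm (gradient f x' - gradient f x) v.
have : n%:R * `|gradient f x' - gradient f x| * `|v| <=
    n%:R * (L * (t * `|v|)) * `|v|.
  by rewrite ler_wpM2r// ler_wpM2l// -xx'; exact: lip.
rewrite !dot_lin ler_norml => le1 /andP[_ le2] le3.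
have : t * (dot (gradient f x') v - dot (gradient f x) v) <=
    t * (n%:R * L * `|v| ^+ 2 * t).
  rewrite ler_pM2l//; apply: le_trans le2 _; apply: le_trans le1 _.
  by rewrite le_eqVlt; apply/orP; left; apply/eqP; ring.
by lra.
Qed.

End ConvexCost.

(** * Decay of the composite Lyapunov function *)

Lemma dot_col_mx (R : realType) m n (a c : 'cV[R]_m) (b d : 'cV[R]_n) :
  dot (col_mx a b) (col_mx c d) = dot a c + dot b d.
Proof. by rewrite /dot tr_col_mx mul_row_col mxE. Qed.

Section TwoTimeScale.
Variables (R : realType) (n m r nc q : nat).
Variables (A Q1 : 'M[R]_n) (L : 'M[R]_(n, m)) (K1 : 'M[R]_(m, q)).
Variables (K2 : 'M[R]_(m, nc)) (C : 'M[R]_(r, n)) (D : 'M[R]_(r, nc)).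
Variables (E : 'M[R]_(nc, n)) (G Q2 : 'M[R]_nc) (J : 'M[R]_(nc, q)).
Variables (Tu : 'M[R]_(m, q)) (Tz : 'M[R]_(r, q)) (P : 'M[R]_q).
Hypothesis symP : P^T = P.

Definition rate1 (e1 : R) (gf : 'cV[R]_m) (gg : 'cV[R]_r) : 'cV[R]_q :=
  - (e1 *: (Tu^T *m gf + Tz^T *m gg)).

Definition rate2 (e2 : R) (y1 : 'cV[R]_n) (y2 : 'cV[R]_nc) : 'cV[R]_nc :=
  - (e2 *: (E *m y1 + G *m y2)).

(** The derivative of (d1, P d1) / 2 + (y1, Q1 y1) + (y2, Q2 y2) along the closed
    loop: d1 is the deviation of the gradient integrator, y1 the one of the plant
    from its steady state, y2 the one of the constraint integrator corrected by
    J d1, and gf, gg are the increments of the gradients. *)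
Definition lyap_rate (e1 e2 : R) d1 y1 y2 gf gg : R :=
  let v1 := rate1 e1 gf gg in let v2 := rate2 e2 y1 y2 in
  dot d1 (P *m v1) +
  2 * dot y1 (Q1 *m (A *m y1 + L *m (K1 *m v1 + K2 *m v2))) +
  2 * dot y2 (Q2 *m (v2 + J *m v1)).

Let W1 := (Q1 *m L *m K1)^T.
Let W2 := (Q2 *m J)^T.

Let crossX : 'M[R]_(m + r, n + nc) :=
  - (2 *: (col_mx Tu Tz *m row_mx W1 W2)) + block_mx 0 K2 C D.
Let crossY1 : 'M[R]_n := - (2 *: (Q1 *m L *m K2 *m E)).
Let crossY2 : 'M[R]_(nc, n) :=
  - (2 *: ((Q1 *m L *m K2 *m G)^T + Q2 *m E)).

Let crossXE y1 y2 gf gg :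
  dot (col_mx gf gg) (crossX *m col_mx y1 y2) =
  - (2 * (dot y1 (Q1 *m (L *m (K1 *m (Tu^T *m gf + Tz^T *m gg)))) +
          dot y2 (Q2 *m (J *m (Tu^T *m gf + Tz^T *m gg))))) +
  dot gf (K2 *m y2) + dot gg (C *m y1 + D *m y2).
Proof.
rewrite /crossX mulmxDl mulNmx -scalemxAl -(mulmxA (col_mx Tu Tz)) mul_row_col.
rewrite (mul_col_mx Tu Tz) mul_block_col mul0mx add0r dotDr dotNr dotZr.
rewrite !dot_col_mx addrA; congr (- (2 * _) + _ + _).
set w := W1 *m y1 + W2 *m y2.
have -> : dot gf (Tu *m w) + dot gg (Tz *m w) = dot (Tu^T *m gf + Tz^T *m gg) w.
  by rewrite dotDl !dot_mulmxl !trmxK.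
by rewrite /w dotDr -!dot_mulmxl ![dot (_ *m _) _]dotC -!mulmxA.
Qed.

Let crossYE y1 y2 :
  dot y1 (crossY1 *m y1) + dot y2 (crossY2 *m y1) =
  - (2 * (dot y1 (Q1 *m (L *m (K2 *m (E *m y1 + G *m y2)))) +
          dot y2 (Q2 *m (E *m y1)))).
Proof.
rewrite /crossY1 /crossY2 !mulNmx -!scalemxAl mulmxDl !dot_lin.
rewrite -dot_mulmxl [dot (_ *m y2) _]dotC -!mulmxA.
by rewrite !mulmxDr dotDr; ring.
Qed.

(** The weight P on d1 turns the slow part into inner products of gf and gg with
    Tu P d1 and Tz P d1; adding and subtracting the fast parts completes these to
    the increments of the input and of the output. *)
Lemma lyap_rateE (e1 e2 : R) d1 y1 y2 gf gg :
  lyap_rate e1 e2 d1 y1 y2 gf gg =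
  2 * dot y1 (Q1 *m (A *m y1)) - 2 * e2 * dot y2 (Q2 *m (G *m y2)) +
  e2 * (dot y1 (crossY1 *m y1) + dot y2 (crossY2 *m y1)) +
  e1 * (dot (col_mx gf gg) (crossX *m col_mx y1 y2)
        - dot gf (Tu *m (P *m d1) + K2 *m y2)
        - dot gg (Tz *m (P *m d1) + C *m y1 + D *m y2)).
Proof.
rewrite crossXE crossYE /lyap_rate /rate1 /rate2.
have : dot d1 (P *m (Tu^T *m gf + Tz^T *m gg)) =
    dot gf (Tu *m (P *m d1)) + dot gg (Tz *m (P *m d1)).
  rewrite -[P in LHS]symP -dot_mulmxl dotC dotDl !dot_mulmxl !trmxK.
  by [].
move: (Tu^T *m gf + Tz^T *m gg) => c cE.
have -> : dot y2 (Q2 *m (E *m y1)) =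
    dot y2 (Q2 *m (E *m y1 + G *m y2)) - dot y2 (Q2 *m (G *m y2)).
  by rewrite [Q2 *m (_ + _)]mulmxDr dotDr addrK.
move: (E *m y1 + G *m y2) => h.
rewrite -!addrA [dot gg (Tz *m _ + _)]dotDr [dot gf (_ + _)]dotDr.
rewrite [A *m y1 + _]addrC !(mulmxDr Q1) !(mulmxDr L) !(mulmxDr Q1) !(mulmxDr Q2).
rewrite !mulmxN -!scalemxAr.
rewrite !dot_lin cE.
by ring.
Qed.

(** Cross terms between the fast variables are absorbed for e2 small, and those
    with the gradient increments, by cocoercivity, for e1 small.  The cost
    functions enter the thresholds only through kap. *)
Lemma lyap_rate_decay (c1 c2 : R) : 0 < c1 -> 0 < c2 ->
  (forall y, dot y (Q1 *m (A *m y)) <= - (c1 * sqnorm2 y)) ->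
  (forall y, c2 * sqnorm2 y <= dot y (Q2 *m (G *m y))) ->
  exists2 e2s : R, 0 < e2s & forall e2 kap : R, 0 < e2 -> e2 < e2s -> 0 < kap ->
  exists2 e1s : R, 0 < e1s & forall e1 : R, 0 < e1 -> e1 < e1s ->
  exists2 k : R, 0 < k & forall d1 y1 y2 gf gg,
    kap * sqnorm2 gf <= dot gf (Tu *m (P *m d1) + K2 *m y2) ->
    kap * sqnorm2 gg <= dot gg (Tz *m (P *m d1) + C *m y1 + D *m y2) ->
    lyap_rate e1 e2 d1 y1 y2 gf gg <=
    - (k * (sqnorm2 y1 + sqnorm2 y2 + sqnorm2 gf + sqnorm2 gg)).
Proof.
move=> c10 c20 decA decG.
have [CX CX0 boundX] := dot_mulmx_bound crossX.
have [C1 C10 boundY1] := dot_mulmx_bound crossY1.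
have [C2 C20 boundY2] := dot_mulmx_bound crossY2.
pose CY := 1 + C1 + C2 / c2.
have CY0 : 0 < CY by rewrite addr_gt0 ?addr_gt0 ?divr_gt0.
exists (c1 / CY) => [|e2 kap e20 e2s kap0]; first exact: divr_gt0.
pose B := 2 * CX / kap; have B0 : 0 < B by rewrite divr_gt0 ?mulr_gt0.
pose c := Num.min c1 (e2 * c2).
have c0 : 0 < c by rewrite lt_min c10 mulr_gt0.
exists (c / (2 * B)) => [|e1 e10 e1s]; first by rewrite divr_gt0// mulr_gt0.
pose k := Num.min (c / 2) (e1 * kap / 2).
have k0 : 0 < k by rewrite lt_min !divr_gt0// mulr_gt0.
exists k => // d1 y1 y2 gf gg cocf cocg; rewrite lyap_rateE.
have colE p1 p2 (a : 'cV[R]_p1) (b : 'cV[R]_p2) :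
    sqnorm2 (col_mx a b) = sqnorm2 a + sqnorm2 b.
  by rewrite !sqnorm2E dot_col_mx.
have kap2 : 0 < kap / 2 by rewrite divr_gt0.
have := boundX (col_mx gf gg) (col_mx y1 y2) _ kap2.
rewrite !colE => /(le_trans (ler_norm _)).
have -> : CX / (kap / 2) = B by rewrite /B; field; rewrite gt_eqF.
have := boundY1 y1 y1 1 ltr01 => /(le_trans (ler_norm _)); rewrite divr1 mul1r.
have := boundY2 y2 y1 c2 c20 => /(le_trans (ler_norm _)).
have := decA y1; have := decG y2.
move: cocf cocg.
set X := dot _ (crossX *m _); set Y1 := dot _ (crossY1 *m _).
set Y2 := dot _ (crossY2 *m _); set du := dot gf _; set dz := dot gg _.
set q1 := dot y1 _; set q2 := dot y2 _.
move: (sqnorm2_ge0 y1) (sqnorm2_ge0 y2) (sqnorm2_ge0 gf) (sqnorm2_ge0 gg).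
move: (sqnorm2 y1) (sqnorm2 y2) (sqnorm2 gf) (sqnorm2 gg) => n1 n2 nf ng.
move=> n10 n20 nf0 ng0 cocf cocg q2le q1le Y2le Y1le Xle.
have e2CY : e2 * CY <= c1 by rewrite -ler_pdivlMr// ltW.
have e1B : e1 * (2 * B) <= c.
  by rewrite -ler_pdivlMr; [exact: ltW | exact: mulr_gt0].
have [cc1 cc2] : c <= c1 /\ c <= e2 * c2 by rewrite !ge_min !lexx orbT.
have [kc ke] : k <= c / 2 /\ k <= e1 * kap / 2 by rewrite !ge_min !lexx orbT.
have Yle : e2 * (Y1 + Y2) <= c1 * n1 + e2 * c2 * n2.
  apply: (@le_trans _ _ (e2 * (CY * n1 + c2 * n2))).
    by rewrite ler_pM2l// /CY; lra.
  by rewrite mulrDr !mulrA lerD2r ler_wpM2r.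
have q2e : e2 * (c2 * n2) <= e2 * q2 by rewrite ler_pM2l.
have Xe : e1 * (X - du - dz) <=
    e1 * (B * (n1 + n2) - kap / 2 * (nf + ng)) by rewrite ler_pM2l//; lra.
have eB : e1 * (2 * B) * (n1 + n2) <= c * (n1 + n2) by rewrite ler_wpM2r// addr_ge0.
have cn1 : c * n1 <= c1 * n1 by rewrite ler_wpM2r.
have cn2 : c * n2 <= e2 * c2 * n2 by rewrite ler_wpM2r.
have kn1 : k * (n1 + n2) <= c / 2 * (n1 + n2) by rewrite ler_wpM2r// addr_ge0.
have kn2 : k * (nf + ng) <= e1 * kap / 2 * (nf + ng) by rewrite ler_wpM2r// addr_ge0.
by lra.
Qed.

End TwoTimeScale.

(** * The steady-state optimization problem *)

Section Problem.
Variables (R : realType) (n m r nw nc q : nat).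
Variables (S : plant R n m r nw) (O : oss_problem R m r nw nc).
Hypothesis hSO : standing_assumptions S O.
Variables (z0 : 'cV[R]_nw -> 'cV[R]_r) (u0 : 'cV[R]_nw -> 'cV[R]_m).
Hypothesis h0 : forall w, ossW O w ->
  block_mx 1%:M (- dcgain_u S) (ossHz O) (ossHu O) *m col_mx (z0 w) (u0 w)
  = col_mx (dcgain_w S) (- ossHw O) *m w.
Variables (Tz : 'M[R]_(r, q)) (Tu : 'M[R]_(m, q)).
Hypothesis hTrank : \rank (col_mx Tz Tu) = q.
Hypothesis hTrange : forall v : 'cV[R]_(r + m),
  (exists xi : 'cV[R]_q, v = col_mx Tz Tu *m xi) <->
  block_mx 1%:M (- dcgain_u S) (ossHz O) (ossHu O) *m v = 0.
Hypothesis hconv : forall w, ossW O w ->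
  strongly_convex_on [set xi : 'cV[R]_q | ossU O (Tu *m xi + u0 w)]
    (fun xi : 'cV[R]_q => (ossf O (Tu *m xi + u0 w)%R
                         + ossg O (Tz *m xi + z0 w)%R)%E).

Implicit Types (xi : 'cV[R]_q) (w : 'cV[R]_nw) (z : 'cV[R]_r) (u : 'cV[R]_m).

Local Notation f := (ossf O).
Local Notation g := (ossg O).
Local Notation Gu := (dcgain_u S).
Local Notation Gw := (dcgain_w S).

Lemma range_T xi : Tz *m xi = Gu *m (Tu *m xi) /\
  ossHz O *m (Tz *m xi) + ossHu O *m (Tu *m xi) = 0.
Proof.
have /hTrange : exists xi', col_mx Tz Tu *m xi = col_mx Tz Tu *m xi' by exists xi.
rewrite (mul_col_mx Tz Tu) mul_block_col -col_mx0 mul1mx mulNmx.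
by move=> /eq_col_mx[/eqP + ->]; rewrite subr_eq0 => /eqP.
Qed.

Lemma kernel_T z u : z = Gu *m u -> ossHz O *m z + ossHu O *m u = 0 ->
  exists xi, z = Tz *m xi /\ u = Tu *m xi.
Proof.
move=> zE e0; have [|xi] := (hTrange (col_mx z u)).2.
  by rewrite mul_block_col mul1mx mulNmx -zE subrr e0 col_mx0.
by rewrite mul_col_mx => /eq_col_mx[-> ->]; exists xi.
Qed.

Lemma Tu_injective xi : Tu *m xi = 0 -> xi = 0.
Proof.
move=> Tu0; have [Tz0 _] := range_T xi; rewrite Tu0 mulmx0 in Tz0.
have T0 : col_mx Tz Tu *m xi = 0 by rewrite mul_col_mx Tz0 Tu0 col_mx0.
have full : row_full (col_mx Tz Tu) by rewrite -col_leq_rank hTrank.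
by have := congr1 (mulmx (pinvmx (col_mx Tz Tu))) T0; rewrite mulmxA mulVpmx// mul1mx mulmx0.
Qed.

Lemma constraints_diff w z u z' u' : constraints S O w z u ->
  constraints S O w z' u' -> exists xi, z' = z + Tz *m xi /\ u' = u + Tu *m xi.
Proof.
move=> [zE eE] [zE' eE'].
have [||xi [zxi uxi]] := @kernel_T (z' - z) (u' - u).
- by rewrite zE zE' mulmxBr opprD addrACA subrr addr0.
- have : ossHz O *m z' + ossHu O *m u' + ossHw O *m w -
      (ossHz O *m z + ossHu O *m u + ossHw O *m w) = 0 by rewrite -eE -eE' subrr.
  by rewrite opprD addrACA subrr addr0 opprD addrACA -!mulmxBr.
by exists xi; rewrite -zxi -uxi !(addrC _ (_ - _)) !subrK.
Qed.

Lemma constraints_add w z u xi : constraints S O w z u ->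
  constraints S O w (z + Tz *m xi) (u + Tu *m xi).
Proof.
move=> [zE eE]; have [Tzxi Txi] := range_T xi; split.
  by rewrite Tzxi mulmxDr addrAC -zE.
by rewrite !mulmxDr addrACA Txi addr0.
Qed.

Lemma constraints_origin w : ossW O w -> constraints S O w (z0 w) (u0 w).
Proof.
move=> /h0; rewrite mul_block_col mul_col_mx mul1mx !mulNmx => /eq_col_mx[zE eE].
split; first by rewrite -zE addrC subrK.
by rewrite eE addNr.
Qed.

(** The difference of two points of the constraint set is T xi, so strong
    convexity in xi holds along every segment of the constraint set. *)
Lemma strongly_convex_segment w : ossW O w -> exists2 mu : R, 0 < mu &
  forall z u xi (t : R), constraints S O w z u -> ossU O u ->
    ossU O (u + Tu *m xi) -> 0 < t -> t < 1 ->
    (f (u + t *: (Tu *m xi))%R + g (z + t *: (Tz *m xi))%R <=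
     t%:E * (f (u + Tu *m xi)%R + g (z + Tz *m xi)%R) +
     (1 - t)%:E * (f u + g z) - (mu / 2 * t * (1 - t) * sqnorm2 xi)%:E)%E.
Proof.
move=> Ww; have [mu mu0 muP] := hconv Ww; exists mu => // z u xi t czu Uu Uxi t0 t1.
have [xi0 [zE uE]] := constraints_diff (constraints_origin Ww) czu.
have base (v : 'cV[R]_q) : u + Tu *m v = Tu *m (v + xi0) + u0 w /\
    z + Tz *m v = Tz *m (v + xi0) + z0 w.
  rewrite uE zE !mulmxDr -!addrA (addrC (u0 w)) (addrC (z0 w)) !addrA.
  by rewrite (addrC (Tu *m v)) (addrC (Tz *m v)).
have [uv zv] := base xi; have [ut zt] := base (t *: xi).
have [u00 z00] := base 0; rewrite !mulmx0 !addr0 add0r in u00 z00.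
have := muP (xi + xi0) xi0 _ _ t t0 t1; rewrite /= -uv -u00 => /(_ Uxi Uu).
have -> : t *: (xi + xi0) + (1 - t) *: xi0 = t *: xi + xi0.
  by rewrite scalerDr scalerBl scale1r -addrA [t *: xi0 + _]addrC subrK.
by rewrite addrK -ut -zt -zv -z00 -!scalemxAr.
Qed.

Let fin_of_le (x y : \bar R) (c : R) : x != -oo%E -> y != -oo%E ->
  (x + y <= c%:E)%E -> x \is a fin_num /\ y \is a fin_num.
Proof. by move: x y => [x| |] [y| |]. Qed.

Let f_notNy u : f u != -oo%E. Proof. exact: cost_notNy (ass_f hSO) u. Qed.
Let g_notNy z : g z != -oo%E. Proof. exact: cost_notNy (ass_g hSO) z. Qed.

Lemma fin_dom_f u : f u \is a fin_num -> ossU O u.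
Proof. by move=> fu; apply: contrapT => /(cost_out (ass_f hSO)) E; rewrite E in fu. Qed.

Lemma fin_dom_g z : g z \is a fin_num -> ossZ O z.
Proof. by move=> gz; apply: contrapT => /(cost_out (ass_g hSO)) E; rewrite E in gz. Qed.

Definition cost z u : R := fine (f u) + fine (g z).

Definition finite z u := f u \is a fin_num /\ g z \is a fin_num.

Lemma optimal_finite w z u : ossW O w -> optimal S O w z u -> finite z u.
Proof.
move=> Ww /(ass_interior hSO Ww)[Zz Uu]; split.
  exact: (cost_fin (ass_f hSO) Uu).
exact: (cost_fin (ass_g hSO) Zz).
Qed.

Lemma cost_segment w : ossW O w -> exists2 mu : R, 0 < mu &
  forall z u xi (t : R), constraints S O w z u -> finite z u ->
    finite (z + Tz *m xi) (u + Tu *m xi) -> 0 < t -> t < 1 ->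
    finite (z + t *: (Tz *m xi)) (u + t *: (Tu *m xi)) /\
    cost (z + t *: (Tz *m xi)) (u + t *: (Tu *m xi)) <=
    t * cost (z + Tz *m xi) (u + Tu *m xi) + (1 - t) * cost z u
    - mu / 2 * t * (1 - t) * sqnorm2 xi.
Proof.
move=> Ww; have [mu mu0 muP] := strongly_convex_segment Ww; exists mu => //.
move=> z u xi t czu [fu gz] [fu' gz'] t0 t1.
have := muP z u xi t czu (fin_dom_f fu) (fin_dom_f fu') t0 t1.
rewrite -(fineK fu) -(fineK gz) -(fineK fu') -(fineK gz').
rewrite -!EFinD => le.
have [fut gzt] := fin_of_le (f_notNy _) (g_notNy _) le.
split=> //; move: le; rewrite -(fineK fut) -(fineK gzt).
by rewrite -EFinD lee_fin.
Qed.

Lemma optimal_cost_le w z u z' u' : ossW O w -> optimal S O w z u ->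
  constraints S O w z' u' -> finite z' u' -> cost z u <= cost z' u'.
Proof.
move=> Ww opt c' [fu' gz']; have [fu gz] := optimal_finite Ww opt.
have := opt.2 z' u' (And3 (fin_dom_g gz') (fin_dom_f fu') c').
rewrite -(fineK fu) -(fineK gz) -(fineK fu') -(fineK gz').
by rewrite -!EFinD lee_fin.
Qed.

(** Strong convexity at the midpoint, where the cost is at least its minimum. *)
Lemma quadratic_growth w : ossW O w -> exists2 mu : R, 0 < mu &
  forall z u xi, optimal S O w z u -> finite (z + Tz *m xi) (u + Tu *m xi) ->
  cost z u + mu * sqnorm2 xi <= cost (z + Tz *m xi) (u + Tu *m xi).
Proof.
move=> Ww; have [mu mu0 muP] := cost_segment Ww; exists (mu / 4) => [|z u xi opt fin].
  by rewrite divr_gt0.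
have czu := opt.1; case: czu => _ _ czu.
have half0 : 0 < 2^-1 :> R by rewrite invr_gt0.
have half1 : 2^-1 < 1 :> R by rewrite invf_lt1// ltr1n.
have [half_fin le] := muP z u xi 2^-1 czu (optimal_finite Ww opt) fin half0 half1.
have := optimal_cost_le Ww opt (constraints_add (2^-1 *: xi) czu).
rewrite -!scalemxAr => /(_ half_fin).
by lra.
Qed.

Lemma optimal_unique w z u z' u' : ossW O w ->
  optimal S O w z u -> optimal S O w z' u' -> z' = z /\ u' = u.
Proof.
move=> Ww opt opt'; have [mu mu0 muP] := quadratic_growth Ww.
have [_ _ c] := opt.1; have [_ _ c'] := opt'.1.
have [xi [zE uE]] := constraints_diff c c'.
have fin' := optimal_finite Ww opt'.
have le' := optimal_cost_le Ww opt' c (optimal_finite Ww opt).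
have : mu * sqnorm2 xi <= 0.
  by have := muP z u xi opt; rewrite -zE -uE => /(_ fin'); lra.
rewrite pmulr_rle0// => xi0.
have /sqnorm2_eq0 xiE : sqnorm2 xi = 0 by apply/eqP; rewrite eq_le xi0 sqnorm2_ge0.
by rewrite zE uE xiE !mulmx0 !addr0.
Qed.

Lemma stationary_optimal w z u : constraints S O w z u ->
  (ossZ O)° z -> (ossU O)° u ->
  Tu^T *m gradient f u + Tz^T *m gradient g z = 0 -> optimal S O w z u.
Proof.
move=> c Zz Uu stat; split.
  by split=> //; [exact: interior_subset Zz | exact: interior_subset Uu].
move=> z' u' [_ _ c']; have [xi [zE uE]] := constraints_diff c c'.
have fu := cost_fin (ass_f hSO) Uu; have gz := cost_fin (ass_g hSO) Zz.
case fu'E: (f u') => [a| |]; last by have := f_notNy u'; rewrite fu'E.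
  case gz'E: (g z') => [b| |]; last by have := g_notNy z'; rewrite gz'E.
    rewrite -(fineK fu) -(fineK gz) -!EFinD lee_fin.
    have := gradient_ineq (ass_f hSO) (y := u') Uu; rewrite fu'E => /(_ isT).
    have := gradient_ineq (ass_g hSO) (y := z') Zz; rewrite gz'E => /(_ isT).
    rewrite uE zE ![_ + _ *m xi]addrC !addrK /=.
    have : dot (Tu^T *m gradient f u + Tz^T *m gradient g z) xi = 0.
      by rewrite stat dot0l.
    by rewrite dotDl !dot_mulmxl !trmxK; lra.
  by rewrite leey.
by rewrite addye ?leey// g_notNy.
Qed.

(** By cost_increment, moving by t along a direction xi of the constraint set
    changes the cost by at most t times the slope at the optimum plus a multiple of
    t^2; so a negative slope would decrease the cost for small t. *)
Lemma optimal_stationary w z u : ossW O w -> optimal S O w z u ->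
  Tu^T *m gradient f u + Tz^T *m gradient g z = 0.
Proof.
move=> Ww opt; have [_ _ c] := opt.1; have [Zz Uu] := ass_interior hSO Ww opt.
have [r1 [L1 [r10 L10 [Ur lip1]]]] := smooth_ball_exists (ass_f hSO) Uu.
have [r2 [L2 [r20 L20 [Zr lip2]]]] := smooth_ball_exists (ass_g hSO) Zz.
have sE v : dot (Tu^T *m gradient f u + Tz^T *m gradient g z) v =
    dot (gradient f u) (Tu *m v) + dot (gradient g z) (Tz *m v).
  by rewrite dotDl !dot_mulmxl !trmxK.
suff slope_ge0 xi :
    0 <= dot (gradient f u) (Tu *m xi) + dot (gradient g z) (Tz *m xi).
  apply/sqnorm2_eq0/eqP; rewrite eq_le sqnorm2_ge0 andbT.
  have := slope_ge0 (- (Tu^T *m gradient f u + Tz^T *m gradient g z)).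
  by rewrite -sE dotNr -sqnorm2E oppr_ge0.
set D := _ + _.
pose C := m%:R * L1 * `|Tu *m xi| ^+ 2 + r%:R * L2 * `|Tz *m xi| ^+ 2 + 1.
have C0 : 0 < C.
  by rewrite ltr_wpDl// addr_ge0// mulr_ge0 ?exprn_ge0// mulr_ge0// ltW.
pose t1 := Num.min (r1 / (`|Tu *m xi| + 1)) (r2 / (`|Tz *m xi| + 1)).
have t10 : 0 < t1 by rewrite lt_min !divr_gt0// ltr_wpDl.
have slope t : 0 < t -> t <= t1 -> - (t * C) <= D.
  move=> t0; rewrite /t1 le_min !ler_pdivlMr ?ltr_wpDl// => /andP[tu tz].
  have ut : t * `|Tu *m xi| <= r1 by lra.
  have zt : t * `|Tz *m xi| <= r2 by lra.
  have c' := constraints_add (t *: xi) c; rewrite -!scalemxAr in c'.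
  have inball (V : normedModType R) (x v : V) s :
      t * `|v| <= s -> `|x + t *: v - x| <= s.
    by rewrite addrC addKr normrZ gtr0_norm.
  have fu' := cost_fin (ass_f hSO) (Ur _ (inball _ u _ _ ut)).
  have gz' := cost_fin (ass_g hSO) (Zr _ (inball _ z _ _ zt)).
  have := optimal_cost_le Ww opt c' (conj fu' gz').
  have := cost_increment (ass_f hSO) t0 L10 (conj Ur lip1) ut.
  have := cost_increment (ass_g hSO) t0 L20 (conj Zr lip2) zt.
  rewrite /cost => le1 le2 le3.
  have : 0 <= t * (D + (C - 1) * t) by rewrite /D /C; lra.
  by rewrite pmulr_rge0//; lra.
rewrite leNgt; apply/negP => D0.
pose t := Num.min t1 (- D / (2 * C)).
have t0 : 0 < t by rewrite lt_min t10 divr_gt0 ?oppr_gt0// mulr_gt0.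
have tC : t * (2 * C) <= - D.
  by rewrite -ler_pdivlMr ?mulr_gt0// ge_min lexx orbT.
have := slope t t0; rewrite ge_min lexx => /(_ isT).
by lra.
Qed.

Variable K2 : 'M[R]_(m, nc).
Hypothesis unitNK : (ossHz O *m Gu + ossHu O) *m K2 \in unitmx.

Local Notation N := (ossHz O *m Gu + ossHu O).

(** The input Ma d, in the range of K2, compensates the effect of a change d of the
    exogenous signal on the constraints. *)
Lemma constraints_shift : exists (Ma : 'M[R]_(m, nw)) (Mb : 'M[R]_(r, nw)),
  forall w d z u, constraints S O w z u ->
    constraints S O (w + d) (z + Mb *m d) (u + Ma *m d).
Proof.
pose e := ossHz O *m Gw + ossHw O.
pose Ma := - (K2 *m invmx (N *m K2) *m e).
have NMa : N *m Ma = - e.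
  by rewrite mulmxN !mulmxA mulmxV// mul1mx.
exists Ma, (Gu *m Ma + Gw) => w d z u [zE eE]; split.
  by rewrite zE !mulmxDr mulmxDl -mulmxA addrACA.
have expand (Au : 'M[R]_(r, m)) (Aw : 'M[R]_(r, nw)) :
    ossHz O *m (z + (Au *m Ma + Aw) *m d) + ossHu O *m (u + Ma *m d) +
    ossHw O *m (w + d) = ossHz O *m z + ossHu O *m u + ossHw O *m w +
    ((ossHz O *m Au + ossHu O) *m Ma + (ossHz O *m Aw + ossHw O)) *m d.
  rewrite !(mulmxDr, mulmxDl) !mulmxA.
  by rewrite [LHS](AC (1*2*2*2) ((1*4*6)*((2*5)*(3*7)))).
by rewrite expand -eE NMa addNr mul0mx addr0.
Qed.

(** Near w1 the optimizers stay in a small ball around the one of w1: on a small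
    sphere of directions xi the cost exceeds its value at the centre by a fixed
    amount, and this survives a small shift of w; by convexity no optimizer is
    outside the shifted sphere. *)
Lemma optimal_near w1 : ossW O w1 -> exists2 L : R, 0 < L &
  \forall w \near w1, ossW O w -> forall z u, optimal S O w z u ->
  exists2 rho : R, 0 < rho &
    smooth_ball (ossU O) f u rho L /\ smooth_ball (ossZ O) g z rho L.
Proof.
move=> Ww1; have [zb [ub opt1]] := ass_optimal hSO Ww1.
have [_ _ c1] := opt1.1; have [Zz Uu] := ass_interior hSO Ww1 opt1.
have [r1 [L1 [r10 L10 sm1]]] := smooth_ball_exists (ass_f hSO) Uu.
have [r2 [L2 [r20 L20 sm2]]] := smooth_ball_exists (ass_g hSO) Zz.
have [G1 G10 lipf] := smooth_ball_lipschitz (ass_f hSO) r10 L10 sm1.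
have [G2 G20 lipg] := smooth_ball_lipschitz (ass_g hSO) r20 L20 sm2.
have [mu mu0 growth] := quadratic_growth Ww1.
have [Cu Cu0 leTu] := norm_mulmx Tu; have [Cz Cz0 leTz] := norm_mulmx Tz.
have [Ma [Mb shift]] := constraints_shift.
have [Ca Ca0 leMa] := norm_mulmx Ma; have [Cb Cb0 leMb] := norm_mulmx Mb.
pose rr := Num.min r1 r2.
have rr0 : 0 < rr by rewrite lt_min r10.
have [rr1 rr2] : rr <= r1 /\ rr <= r2 by rewrite !ge_min !lexx orbT.
(* T xi has norm at most rr / 4 for |xi| <= s, and so has the shift of the
   constraint set for |w - w1| < eps *)
pose s := rr / (4 * (Cu + Cz)).
have s0 : 0 < s by rewrite divr_gt0// mulr_gt0// addr_gt0.
have sC : s * (4 * (Cu + Cz)) = rr by rewrite divfK// gt_eqF// mulr_gt0// addr_gt0.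
have [sCu sCz] : Cu * s <= rr / 4 /\ Cz * s <= rr / 4 by split; nra.
(* the second bound keeps the changes of the cost by the shift, at the centre and
   on the sphere together, below the growth mu * s ^+ 2 *)
pose eps := Num.min (rr / (4 * (Ca + Cb))) (mu * s ^+ 2 / (2 * (G1 * Ca + G2 * Cb))).
have GC0 : 0 < 2 * (G1 * Ca + G2 * Cb) by rewrite mulr_gt0// addr_gt0// mulr_gt0.
have eps0 : 0 < eps.
  rewrite lt_min; apply/andP; split; apply: divr_gt0 => //.
    by rewrite mulr_gt0// addr_gt0.
  by rewrite mulr_gt0// exprn_gt0.
exists (Num.max L1 L2); first by rewrite lt_max L10.
apply: filterS (nbhsx_ballx w1 eps eps0) => w;
  rewrite -ball_normE/= distrC => dw Ww z u opt.
set d := w - w1 in dw.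
have dC : `|d| * (4 * (Ca + Cb)) <= rr.
  by rewrite -ler_pdivlMr ?mulr_gt0 ?addr_gt0//; apply: ltW; apply: lt_le_trans dw _; rewrite ge_min lexx.
have dG : `|d| * (2 * (G1 * Ca + G2 * Cb)) < mu * s ^+ 2.
  by rewrite -ltr_pdivlMr//; apply: lt_le_trans dw _; rewrite ge_min lexx orbT.
have := shift w1 d zb ub c1; rewrite /d addrC subrK -/d.
set a := Ma *m d; set b := Mb *m d => cw.
have aC : `|a| <= Ca * `|d| by exact: leMa.
have bC : `|b| <= Cb * `|d| by exact: leMb.
have d0 : 0 <= `|d| by [].
have [a4 b4] : `|a| <= rr / 4 /\ `|b| <= rr / 4 by split; nra.
have [_ _ c] := opt.1.
have [xi [zE uE]] := constraints_diff cw c.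
have Tsmall (v : 'cV[R]_q) : `|v| <= s -> `|Tu *m v| <= rr / 4 /\ `|Tz *m v| <= rr / 4.
  by move=> vs; have := leTu v; have := leTz v; split; nra.
have inball p (x y e : 'cV[R]_p) : `|x| <= rr / 4 -> `|y| <= rr / 4 ->
    `|e + x + y - e| <= rr / 2.
  move=> xr yr; rewrite addrAC (addrC e) addrK; apply: le_trans (ler_normD _ _) _.
  by lra.
have half0 p : `|0 : 'cV[R]_p| <= rr / 4 by rewrite normr0; lra.
have hr1 p (x e : 'cV[R]_p) : `|x - e| <= rr / 2 -> `|x - e| <= r1 by lra.
have hr2 p (x e : 'cV[R]_p) : `|x - e| <= rr / 2 -> `|x - e| <= r2 by lra.
have xis : sqnorm2 xi <= s ^+ 2.
  rewrite leNgt; apply/negP => xi_large.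
  have sq0 : 0 < sqnorm2 xi by apply: lt_trans xi_large; rewrite exprn_gt0.
  (* where the segment from the shifted centre to (z, u) crosses the sphere *)
  pose th := s / Num.sqrt (sqnorm2 xi).
  have sqrt0 : 0 < Num.sqrt (sqnorm2 xi) by rewrite sqrtr_gt0.
  have th0 : 0 < th by rewrite divr_gt0.
  have th1 : th < 1.
    rewrite ltr_pdivrMr// mul1r -ltr_sqr ?nnegrE ?sqrtr_ge0 ?(ltW s0)//.
    by rewrite sqr_sqrtr// ltW.
  have thxi : sqnorm2 (th *: xi) = s ^+ 2.
    by rewrite sqnorm2Z expr_div_n sqr_sqrtr ?(ltW sq0)// divfK// gt_eqF.
  have nth : `|th *: xi| <= s.
    by rewrite -ler_sqr ?nnegrE ?(ltW s0)// -thxi norm_sqnorm2.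
  have [mu' mu'0 seg] := cost_segment Ww.
  have [tu tz] := Tsmall _ nth; rewrite -!scalemxAr in tu tz.
  have ball_ub x : `|x - ub| <= r1 -> f x \is a fin_num.
    by move=> /sm1.1; exact: cost_fin (ass_f hSO) _.
  have ball_zb x : `|x - zb| <= r2 -> g x \is a fin_num.
    by move=> /sm2.1; exact: cost_fin (ass_g hSO) _.
  have a_in : `|ub + a - ub| <= r1.
    by have := hr1 _ _ _ (inball _ a 0 ub a4 (half0 _)); rewrite addr0.
  have b_in : `|zb + b - zb| <= r2.
    by have := hr2 _ _ _ (inball _ b 0 zb b4 (half0 _)); rewrite addr0.
  have tu_in : `|ub + th *: (Tu *m xi) - ub| <= r1.
    by have := hr1 _ _ _ (inball _ 0 _ ub (half0 _) tu); rewrite addr0.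
  have tz_in : `|zb + th *: (Tz *m xi) - zb| <= r2.
    by have := hr2 _ _ _ (inball _ 0 _ zb (half0 _) tz); rewrite addr0.
  have atu_in := hr1 _ _ _ (inball _ _ _ ub a4 tu).
  have btz_in := hr2 _ _ _ (inball _ _ _ zb b4 tz).
  have fin0 : finite (zb + b) (ub + a) by split; [exact: ball_ub|exact: ball_zb].
  have fin1 := optimal_finite Ww opt.
  have := seg _ _ xi th cw fin0; rewrite -zE -uE => /(_ fin1 th0 th1)[_ seg_le].
  have opt_le := optimal_cost_le Ww opt cw fin0.
  have pos : 0 <= mu' / 2 * th * (1 - th) * sqnorm2 xi.
    apply/ltW/mulr_gt0 => //; apply: mulr_gt0; last by rewrite subr_gt0.
    by apply: mulr_gt0 => //; exact: divr_gt0.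
  have grow := growth zb ub (th *: xi) opt1; rewrite -!scalemxAr thxi in grow.
  have {}grow := grow (conj (ball_ub _ tu_in) (ball_zb _ tz_in)).
  have u_in : `|ub - ub| <= r1 by rewrite subrr normr0 ltW.
  have z_in : `|zb - zb| <= r2 by rewrite subrr normr0 ltW.
  have dist_shift p (e x y : 'cV[R]_p) : e + x + y - (e + y) = x.
    by rewrite (addrC e x) -(addrA x) addrK.
  have := lipf _ _ atu_in tu_in; rewrite dist_shift ler_norml => /andP[lf _].
  have := lipg _ _ btz_in tz_in; rewrite dist_shift ler_norml => /andP[lg _].
  have := lipf _ _ a_in u_in; rewrite (addrC ub) addrK ler_norml => /andP[_ lf0].
  have := lipg _ _ b_in z_in; rewrite (addrC zb) addrK ler_norml => /andP[_ lg0].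
  have G1a : G1 * `|a| <= G1 * (Ca * `|d|) by rewrite ler_pM2l.
  have G2b : G2 * `|b| <= G2 * (Cb * `|d|) by rewrite ler_pM2l.
  have th_le : th * cost z u <= th * cost (zb + b) (ub + a) by rewrite ler_pM2l.
  move: lf lg lf0 lg0 seg_le grow th_le.
  rewrite (addrC a) (addrC b) /cost; lra.
have xi_s : `|xi| <= s.
  by rewrite -ler_sqr ?nnegrE ?(ltW s0)//; apply: le_trans (norm_sqnorm2 _) xis.
have [tu tz] := Tsmall _ xi_s.
exists (rr / 2); first by rewrite divr_gt0.
have := inball _ _ _ ub a4 tu; have := inball _ _ _ zb b4 tz.
rewrite -uE -zE => zr ur; split.
  by apply: smooth_ballW sm1; [lra | rewrite le_max lexx].
by apply: smooth_ballW sm2; [lra | rewrite le_max lexx orbT].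
Qed.

(** Compactness of W makes the constant of optimal_near uniform. *)
Lemma uniform_smoothness : exists2 L : R, 0 < L &
  forall w, ossW O w -> forall z u, optimal S O w z u ->
  exists2 rho : R, 0 < rho &
    smooth_ball (ossU O) f u rho L /\ smooth_ball (ossZ O) g z rho L.
Proof.
have /compact_near_coveringP cover := ass_W_compact hSO.
pose P (L : R) w := ossW O w -> forall z u, optimal S O w z u ->
  exists2 rho : R, 0 < rho &
    smooth_ball (ossU O) f u rho L /\ smooth_ball (ossZ O) g z rho L.
have near_P : \forall L \near +oo, ossW O `<=` P L.
  apply: cover => w1 Ww1; have [L0 L00 nearL0] := optimal_near Ww1.
  exists ([set w | P L0 w], [set L | L0 <= L]); first split => //=.
    by apply: nbhs_pinfty_ge; rewrite num_real.
  move=> [w L] [/= Pw LL] Ww z u opt; have [rho rho0 [smf smg]] := Pw Ww z u opt.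
  exists rho => //; split; [apply: smooth_ballW smf|apply: smooth_ballW smg] => //;
    by rewrite subrr normr0 add0r.
near (+oo : set_system R) => L.
have WL : ossW O `<=` P L by near: L.
exists L; first by near: L; exact: nbhs_pinfty_gt.
by move=> w Ww; exact: WL.
Unshelve. all: by end_near. Qed.

(** * Equilibria of the closed loop *)

Hypothesis unitA : plA S \in unitmx.
Variables (P : 'M[R]_q) (K1 : 'M[R]_(m, q)).
Hypothesis hP : posdef P.
Hypothesis hK1 : (1%:M - K2 *m invmx (N *m K2) *m N) *m K1 = Tu *m P.
Variables tau1 tau2 : R.
Hypotheses (tau10 : 0 < tau1) (tau20 : 0 < tau2).

Local Notation K := (gradient_controller O Tz Tu K1 K2 tau1 tau2).
Local Notation state := ('cV[R]_n * ('cV[R]_q * 'cV[R]_nc))%type.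
Local Notation J := (invmx (N *m K2) *m (N *m K1)).

Lemma NTu (xi : 'cV[R]_q) : N *m (Tu *m xi) = 0.
Proof. by have [Tzxi <-] := range_T xi; rewrite mulmxDl -mulmxA -Tzxi. Qed.

(** In the coordinates P eta1 and eta2 + J eta1, the first one moves the input
    along the feasible directions and the second one across them. *)
Lemma input_coordinates (e1 : 'cV[R]_q) (e2 : 'cV[R]_nc) :
  K1 *m e1 + K2 *m e2 = Tu *m (P *m e1) + K2 *m (e2 + J *m e1).
Proof.
have -> : Tu *m (P *m e1) = K1 *m e1 - K2 *m (J *m e1).
  by rewrite mulmxA -hK1 (mulmxBl 1%:M) mul1mx (mulmxBl K1) -!mulmxA.
by rewrite [K2 *m (e2 + _)]mulmxDr (addrC (K2 *m e2)) addrA subrK.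
Qed.

Lemma input_injective (e1 : 'cV[R]_q) (e2 : 'cV[R]_nc) :
  K1 *m e1 + K2 *m e2 = 0 -> e1 = 0 /\ e2 = 0.
Proof.
rewrite input_coordinates => E.
have y0 : e2 + J *m e1 = 0.
  have := congr1 (mulmx N) E; rewrite mulmxDr NTu add0r mulmx0 mulmxA.
  by move=> /(congr1 (mulmx (invmx (N *m K2)))); rewrite mulKmx// mulmx0.
have e10 : e1 = 0.
  rewrite y0 mulmx0 addr0 in E; have PE := Tu_injective E.
  by rewrite -[e1](mulKmx (posdef_unit hP)) PE mulmx0.
by split=> //; move: y0; rewrite e10 mulmx0 addr0.
Qed.

Lemma steady_output w x u :
  plA S *m x + plB S *m u + plBw S *m w = 0 ->
  plC S *m x + plD S *m u + plDw S *m w = Gu *m u + Gw *m w.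
Proof.
move=> /eqP; rewrite -addrA addr_eq0 => /eqP /(congr1 (mulmx (invmx (plA S)))).
rewrite mulKmx// => ->.
rewrite /dcgain_u /dcgain_w !mulmxDl !mulNmx !mulmxN !mulmxDr opprD !mulmxA.
by rewrite [LHS](AC (2*1*1) ((1*3)*(2*4))).
Qed.

Lemma equilibrium_eqs w (p : state) :
  equilibrium (cl_dom S K w) (cl_field S O K w) p <->
  [/\ (ossU O)° (cl_u K p), (ossZ O)° (cl_z S K w p),
      plA S *m p.1 + plB S *m cl_u K p + plBw S *m w = 0,
      constraints S O w (cl_z S K w p) (cl_u K p) &
      Tu^T *m gradient f (cl_u K p) + Tz^T *m gradient g (cl_z S K w p) = 0].
Proof.
split.
  move=> [[Uu Zz] /pair_equal_spec[/= xE /pair_equal_spec[/= gE eE]]].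
  have e0 : cl_e S O K w p = 0.
    move/eqP: eE; rewrite scaler_eq0 invr_eq0 gt_eqF//= oppr_eq0.
    by move/eqP.
  split=> //; first split; first exact: (steady_output xE).
    by rewrite -[LHS]e0.
  move/eqP: gE; rewrite scaler_eq0 invr_eq0 gt_eqF//= -opprD oppr_eq0.
  by move/eqP.
move=> [Uu Zz xE [zE eE] gE]; split; first by split.
rewrite /cl_field xE /= -opprD -/(cl_u K p) gE oppr0 scaler0.
by rewrite /cl_e -eE oppr0 scaler0.
Qed.

Lemma equilibrium_optimal w (p : state) :
  equilibrium (cl_dom S K w) (cl_field S O K w) p ->
  optimal S O w (cl_z S K w p) (cl_u K p).
Proof. by move=> /equilibrium_eqs[Uu Zz _ c gE]; exact: stationary_optimal. Qed.

Lemma equilibrium_unique w (p p' : state) : ossW O w ->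
  equilibrium (cl_dom S K w) (cl_field S O K w) p ->
  equilibrium (cl_dom S K w) (cl_field S O K w) p' -> p' = p.
Proof.
move=> Ww eq eq'.
have [_ uE] := optimal_unique Ww (equilibrium_optimal eq) (equilibrium_optimal eq').
have [_ _ xE _ _] := (equilibrium_eqs w p).1 eq.
have [_ _ xE' _ _] := (equilibrium_eqs w p').1 eq'.
have x12 : p'.1 = p.1.
  rewrite -[p'.1](mulKmx unitA) -[p.1](mulKmx unitA); congr (_ *m _).
  by move: xE'; rewrite uE -xE => /addIr/addIr.
have [] := @input_injective (p'.2.1 - p.2.1) (p'.2.2 - p.2.2).
  rewrite !mulmxBr addrACA -opprD; apply/eqP; rewrite subr_eq0; apply/eqP.
  exact: uE.
move=> /eqP + /eqP; rewrite !subr_eq0 => /eqP e1 /eqP e2.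
by case: p p' x12 e1 e2 {eq eq' uE xE xE'} => [x [y1 y2]] [x' [y1' y2']] /= -> -> ->.
Qed.

Lemma equilibrium_exists w : ossW O w ->
  exists p : state, equilibrium (cl_dom S K w) (cl_field S O K w) p.
Proof.
move=> Ww; have [zb [ub opt]] := ass_optimal hSO Ww.
have [Zz Uu] := ass_interior hSO Ww opt; have [_ _ [zE eE]] := opt.1.
have gE := optimal_stationary Ww opt.
pose y2 := invmx (N *m K2) *m (N *m ub).
have [|xi [_ uxi]] := @kernel_T (Gu *m (ub - K2 *m y2)) (ub - K2 *m y2) erefl.
  rewrite mulmxA -mulmxDl mulmxBr /y2 (mulmxA N) (mulmxA (N *m K2)) mulmxV//.
  by rewrite mul1mx subrr.
pose e1 := invmx P *m xi; pose e2 := y2 - J *m e1.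
pose x := - (invmx (plA S) *m (plB S *m ub + plBw S *m w)).
have uE : K1 *m e1 + K2 *m e2 = ub.
  by rewrite input_coordinates /e2 subrK mulKVmx ?posdef_unit// -uxi subrK.
have xE : plA S *m x + plB S *m ub + plBw S *m w = 0.
  by rewrite /x mulmxN mulKVmx// -addrA addNr.
exists (x, (e1, e2)); apply/equilibrium_eqs.
have uE' : cl_u K (x, (e1, e2)) = ub by exact: uE.
have zE' : cl_z S K w (x, (e1, e2)) = zb.
  by rewrite /cl_z uE' (steady_output xE) zE.
by rewrite uE' zE'; split.
Qed.

(** * Stability of the closed loop *)

(** By quadratic growth the slope of the cost in direction xi is at least a
    multiple of |xi|^2 at the point of the constraint set with coordinate xi, and
    it vanishes at the optimum; so between these two points the gradients change by
    at least a multiple of |xi|.  Replacing the first point by (z, u) changes the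
    gradients by at most a multiple of the distance. *)
Lemma slow_bound w zb ub (rho L : R) : ossW O w -> optimal S O w zb ub ->
  0 < rho -> 0 < L ->
  smooth_ball (ossU O) f ub rho L -> smooth_ball (ossZ O) g zb rho L ->
  exists2 C : R, 0 < C & forall xi u z,
    `|Tu *m xi| <= rho -> `|Tz *m xi| <= rho ->
    `|u - ub| <= rho -> `|z - zb| <= rho ->
    sqnorm2 xi <= C *
      (sqnorm2 (u - ub - Tu *m xi) + sqnorm2 (z - zb - Tz *m xi) +
       sqnorm2 (gradient f u - gradient f ub) +
       sqnorm2 (gradient g z - gradient g zb)).
Proof.
move=> Ww opt rho0 L0 [Ur lipf] [Zr lipg].
have [mu mu0 growth] := quadratic_growth Ww.
have [Cu Cu0 leTu] := sqnorm2_mulmx Tu; have [Cz Cz0 leTz] := sqnorm2_mulmx Tz.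
(* with this weight the Young inequality uses up half of the growth *)
pose t := mu / (Cu + Cz).
have t0 : 0 < t by rewrite divr_gt0// addr_gt0.
have tmu : t * (Cu + Cz) = mu by rewrite divfK// gt_eqF// addr_gt0.
pose c := 1 + m%:R * L ^+ 2 + r%:R * L ^+ 2.
have c0 : 0 < c.
  by rewrite /c -addrA ltr_pwDl// addr_ge0// mulr_ge0// exprn_ge0// ltW.
exists ((t * mu)^-1 * (2 * c)) => [|xi u z tu tz ur zr].
  by apply: mulr_gt0; [rewrite invr_gt0; exact: mulr_gt0 | exact: mulr_gt0].
have inball p (x v : 'cV[R]_p) : `|v| <= rho -> `|x + v - x| <= rho.
  by rewrite (addrC x) addrK.
have ar := inball _ ub _ tu; have br := inball _ zb _ tz.
set a := ub + Tu *m xi in ar; set b := zb + Tz *m xi in br.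
have fa := cost_fin (ass_f hSO) (Ur _ ar); have gb := cost_fin (ass_g hSO) (Zr _ br).
have grow := growth zb ub xi opt (conj fa gb).
have [fu gz] := optimal_finite Ww opt.
have := gradient_ineq (ass_f hSO) (Ur _ ar) fu.
have := gradient_ineq (ass_g hSO) (Zr _ br) gz.
have -> : ub - a = - (Tu *m xi) by rewrite opprD addNKr.
have -> : zb - b = - (Tz *m xi) by rewrite opprD addNKr.
rewrite !dotNr => ineqg ineqf.
have stat : dot (gradient f ub) (Tu *m xi) + dot (gradient g zb) (Tz *m xi) = 0.
  have := congr1 (fun v => dot v xi) (optimal_stationary Ww opt).
  by rewrite dot0l dotDl !dot_mulmxl !trmxK.
have yf := young (Tu *m xi) (gradient f a - gradient f ub) t0.
have yg := young (Tz *m xi) (gradient g b - gradient g zb) t0.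
rewrite dotBr [dot _ (gradient f a)]dotC [dot _ (gradient f ub)]dotC in yf.
rewrite dotBr [dot _ (gradient g b)]dotC [dot _ (gradient g zb)]dotC in yg.
have tT : t * (sqnorm2 (Tu *m xi) + sqnorm2 (Tz *m xi)) <= mu * sqnorm2 xi.
  rewrite -tmu -mulrA ler_pM2l// mulrDl; apply: lerD; [exact: leTu|exact: leTz].
have lip_sq p (h : 'cV[R]_p -> 'cV[R]_p) (x y : 'cV[R]_p) :
    `|h x - h y| <= L * `|x - y| ->
    sqnorm2 (h x - h y) <= p%:R * L ^+ 2 * sqnorm2 (y - x).
  move=> hL; apply: le_trans (sqnorm2_norm _) _; rewrite -mulrA ler_wpM2l//.
  rewrite -sqnorm2N opprB; apply: (@le_trans _ _ ((L * `|x - y|) ^+ 2)).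
    by rewrite ler_pXn2r ?nnegrE ?mulr_ge0 ?(ltW L0).
  by rewrite exprMn ler_wpM2l ?exprn_ge0 ?(ltW L0)// norm_sqnorm2.
have ef := lip_sq _ _ _ _ (lipf _ _ ar ur).
have eg := lip_sq _ _ _ _ (lipg _ _ br zr).
have hf := sqnorm2D (gradient f a - gradient f u) (gradient f u - gradient f ub).
have hg := sqnorm2D (gradient g b - gradient g z) (gradient g z - gradient g zb).
rewrite !subrKA in hf hg.
have ua : u - a = u - ub - Tu *m xi by rewrite opprD addrA.
have zb' : z - b = z - zb - Tz *m xi by rewrite opprD addrA.
rewrite ua in ef; rewrite zb' in eg.
have tmu0 : 0 < t * mu by exact: mulr_gt0.
rewrite -mulrA [leRHS]mulrC ler_pdivlMr//.
move: ef eg hf hg yf yg tT grow ineqf ineqg stat; rewrite /cost -/a -/b.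
set hf := sqnorm2 (gradient f a - gradient f ub).
set hg := sqnorm2 (gradient g b - gradient g zb).
set ef := sqnorm2 (gradient f a - gradient f u).
set eg := sqnorm2 (gradient g b - gradient g z).
move: (sqnorm2_ge0 (u - ub - Tu *m xi)) (sqnorm2_ge0 (z - zb - Tz *m xi)).
move: (sqnorm2_ge0 (gradient f u - gradient f ub)).
move: (sqnorm2_ge0 (gradient g z - gradient g zb)).
move: (sqnorm2 (u - _ - _)) (sqnorm2 (z - _ - _)) => su sz.
move: (sqnorm2 (gradient f u - _)) (sqnorm2 (gradient g z - _)) => gf gg.
move=> gg0 gf0 su0 sz0 ef_le eg_le hf_le hg_le yf yg tT grow ineqf ineqg stat.
have H : mu * sqnorm2 xi <= t^-1 * (hf + hg) by lra.
have {}H : sqnorm2 xi * (t * mu) <= hf + hg.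
  have -> : sqnorm2 xi * (t * mu) = t * (mu * sqnorm2 xi) by ring.
  by rewrite -ler_pdivlMl.
apply: le_trans H _.
have nm : 0 <= m%:R * L ^+ 2 by rewrite mulr_ge0// exprn_ge0// ltW.
have nr : 0 <= r%:R * L ^+ 2 by rewrite mulr_ge0// exprn_ge0// ltW.
have := mulr_ge0 nm (addr_ge0 (addr_ge0 sz0 gf0) gg0).
have := mulr_ge0 nr (addr_ge0 (addr_ge0 su0 gf0) gg0).
by rewrite /c; lra.
Qed.

Local Notation LB := (invmx (plA S) *m plB S).

(** The deviation of the plant state from the steady state of the current input,
    up to a constant. *)
Definition fast_plant (s : state) : 'cV[R]_n := s.1 + LB *m cl_u K s.

Definition fast_integrator (s : state) : 'cV[R]_nc := s.2.2 + J *m s.2.1.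

Lemma lip_input : lip (fun s : state => cl_u K s).
Proof.
apply: lip_add; apply: lip_mulmx.
  by apply: lip_fst; apply: lip_snd; exact: lip_id.
by apply: lip_snd; apply: lip_snd; exact: lip_id.
Qed.

Lemma lip_output w : lip (fun s : state => cl_z S K w s).
Proof.
apply: lip_add; last exact: lip_cst.
apply: lip_add; apply: lip_mulmx; last exact: lip_input.
by apply: lip_fst; exact: lip_id.
Qed.

Lemma lip_fast_plant : lip fast_plant.
Proof.
apply: lip_add; first by apply: lip_fst; exact: lip_id.
by apply: lip_mulmx; exact: lip_input.
Qed.

Lemma lip_fast_integrator : lip fast_integrator.
Proof.
apply: lip_add; first by apply: lip_snd; apply: lip_snd; exact: lip_id.
by apply: lip_mulmx; apply: lip_fst; apply: lip_snd; exact: lip_id.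
Qed.

Lemma lip_slow : lip (fun s : state => s.2.1).
Proof. by apply: lip_fst; apply: lip_snd; exact: lip_id. Qed.

Lemma input_diff (s p : state) : cl_u K s - cl_u K p =
  Tu *m (P *m (s.2.1 - p.2.1)) + K2 *m (fast_integrator s - fast_integrator p).
Proof.
rewrite /cl_u /= opprD addrACA -!mulmxBr input_coordinates.
congr (_ + _ *m _).
by rewrite /fast_integrator [in RHS]opprD [RHS]addrACA -[in RHS]mulmxBr.
Qed.

Lemma output_diff w (s p : state) : cl_z S K w s - cl_z S K w p =
  Tz *m (P *m (s.2.1 - p.2.1)) + plC S *m (fast_plant s - fast_plant p) +
  Gu *m K2 *m (fast_integrator s - fast_integrator p).
Proof.
have [-> _] := range_T (P *m (s.2.1 - p.2.1)).
have -> : Gu *m K2 *m (fast_integrator s - fast_integrator p) =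
    Gu *m (cl_u K s - cl_u K p) - Gu *m (Tu *m (P *m (s.2.1 - p.2.1))).
  rewrite input_diff [Gu *m (_ + _)]mulmxDr.
  by rewrite (addrC (Gu *m (Tu *m _))) addrK mulmxA.
have cancel (a b c : 'cV[R]_r) : a + b + (c - a) = b + c.
  by rewrite addrC addrA subrK addrC.
rewrite cancel.
have -> : cl_z S K w s - cl_z S K w p =
    plC S *m (s.1 - p.1) + plD S *m (cl_u K s - cl_u K p).
  by rewrite /cl_z opprD addrACA subrr addr0 opprD addrACA -!mulmxBr.
have -> : fast_plant s - fast_plant p = s.1 - p.1 + LB *m (cl_u K s - cl_u K p).
  by rewrite /fast_plant opprD addrACA -mulmxBr.
move: (s.1 - p.1) (cl_u K s - cl_u K p) => dx du.
by rewrite /dcgain_u mulmxDl mulNmx mulmxDr !mulmxA -addrA addNKr.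
Qed.

Lemma field_plant w (s p : state) :
  equilibrium (cl_dom S K w) (cl_field S O K w) p ->
  (cl_field S O K w s).1 = plA S *m (fast_plant s - fast_plant p).
Proof.
move=> /equilibrium_eqs[_ _ /eqP + _ _]; rewrite addr_eq0 => /eqP xE.
have AY v : plA S *m fast_plant v = plA S *m v.1 + plB S *m cl_u K v.
  by rewrite /fast_plant mulmxDr !mulmxA mulmxV// mul1mx.
by rewrite mulmxBr !AY xE opprK.
Qed.

Lemma field_slow w (s p : state) :
  equilibrium (cl_dom S K w) (cl_field S O K w) p ->
  (cl_field S O K w s).2.1 = rate1 Tu Tz tau1^-1
    (gradient f (cl_u K s) - gradient f (cl_u K p))
    (gradient g (cl_z S K w s) - gradient g (cl_z S K w p)).
Proof.
move=> /equilibrium_eqs[_ _ _ _ stat].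
rewrite /rate1 -scalerN !mulmxBr addrACA -opprD stat subr0 opprD.
by [].
Qed.

Lemma field_integrator w (s p : state) :
  equilibrium (cl_dom S K w) (cl_field S O K w) p ->
  (cl_field S O K w s).2.2 = rate2 (ossHz O *m plC S) (N *m K2) tau2^-1
    (fast_plant s - fast_plant p) (fast_integrator s - fast_integrator p).
Proof.
move=> /equilibrium_eqs[_ _ _ [_ eE] _].
rewrite /rate2 -scalerN.
suff -> : ossHz O *m plC S *m (fast_plant s - fast_plant p) +
    N *m K2 *m (fast_integrator s - fast_integrator p) = cl_e S O K w s by [].
have -> : cl_e S O K w s =
    ossHz O *m (cl_z S K w s - cl_z S K w p) + ossHu O *m (cl_u K s - cl_u K p).
  rewrite -[LHS]subr0 eE /cl_e opprD addrACA subrr addr0 opprD addrACA.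
  by rewrite -!mulmxBr.
rewrite output_diff input_diff.
have [_ Txi] := range_T (P *m (s.2.1 - p.2.1)).
move: (fast_plant s - _) (fast_integrator s - _) (P *m (s.2.1 - p.2.1)) Txi.
move=> y1 y2 xi Txi; move: (dcgain_u S) => Au.
rewrite !(mulmxDr (ossHz O)) (mulmxDr (ossHu O)) !mulmxDl -!mulmxA.
by rewrite [RHS]addrACA (addrAC (ossHz O *m (Tz *m xi))) Txi add0r.
Qed.

Section AtEquilibrium.
Variables (w : 'cV[R]_nw) (p : state).
Hypothesis Ww : ossW O w.
Hypothesis eqp : equilibrium (cl_dom S K w) (cl_field S O K w) p.
Variables (rho L : R).
Hypotheses (rho0 : 0 < rho) (L0 : 0 < L).
Hypothesis smf : smooth_ball (ossU O) f (cl_u K p) rho L.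
Hypothesis smg : smooth_ball (ossZ O) g (cl_z S K w p) rho L.
Variables (Q1 : 'M[R]_n) (Q2 : 'M[R]_nc) (c1 c2 kap k : R).
Hypotheses (symQ1 : Q1^T = Q1) (symQ2 : Q2^T = Q2).
Hypotheses (c10 : 0 < c1) (c20 : 0 < c2) (kap0 : 0 < kap) (k0 : 0 < k).
Hypothesis lowQ1 : forall v, c1 * sqnorm2 v <= dot v (Q1 *m v).
Hypothesis lowQ2 : forall v, c2 * sqnorm2 v <= dot v (Q2 *m v).
Hypothesis kap_f : kap * (2 * m.+1%:R * L) <= 1.
Hypothesis kap_g : kap * (2 * r.+1%:R * L) <= 1.
Hypothesis decay : forall d1 y1 y2 gf gg,
  kap * sqnorm2 gf <= dot gf (Tu *m (P *m d1) + K2 *m y2) ->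
  kap * sqnorm2 gg <=
    dot gg (Tz *m (P *m d1) + plC S *m y1 + Gu *m K2 *m y2) ->
  lyap_rate (plA S) Q1 LB K1 K2 (ossHz O *m plC S) (N *m K2) Q2 J Tu Tz P
    tau1^-1 tau2^-1 d1 y1 y2 gf gg <=
  - (k * (sqnorm2 y1 + sqnorm2 y2 + sqnorm2 gf + sqnorm2 gg)).

Let d1 (s : state) := s.2.1 - p.2.1.
Let y1 (s : state) := fast_plant s - fast_plant p.
Let y2 (s : state) := fast_integrator s - fast_integrator p.
Let du (s : state) := cl_u K s - cl_u K p.
Let dz (s : state) := cl_z S K w s - cl_z S K w p.
Let gf (s : state) := gradient f (cl_u K s) - gradient f (cl_u K p).
Let gg (s : state) := gradient g (cl_z S K w s) - gradient g (cl_z S K w p).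

Definition lyap (s : state) : R :=
  2^-1 * dot (d1 s) (P *m d1 s) + dot (y1 s) (Q1 *m y1 s)
  + dot (y2 s) (Q2 *m y2 s).

Let symP : P^T = P. Proof. by case: hP. Qed.

Lemma lyap_continuous : continuous lyap.
Proof.
have cont_quad j (h : state -> 'cV[R]_j) (Q : 'M[R]_j) : lip h ->
    continuous (fun s => dot (h s - h p) (Q *m (h s - h p))).
  move=> hL; have dL : lip (fun s => h s - h p).
    by apply: lip_add => //; exact: lip_cst.
  apply: continuous_dot; apply: lip_continuous => //; exact: lip_mulmx.
move=> s; have q0 := cont_quad _ _ P lip_slow s.
have q1 := cont_quad _ _ Q1 lip_fast_plant s.
have q2 := cont_quad _ _ Q2 lip_fast_integrator s.
exact: cvgD (cvgD (cvgM (cvg_cst _) q0) q1) q2.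
Qed.

Lemma lyap_upper : exists2 be : R, 0 < be &
  forall s, lyap s <= be * `|s - p| ^+ 2.
Proof.
have [B0 B00 le0] := lip_quad_upper P lip_slow.
have [B1 B10 le1] := lip_quad_upper Q1 lip_fast_plant.
have [B2 B20 le2] := lip_quad_upper Q2 lip_fast_integrator.
exists (B0 + B1 + B2) => [|s]; first by rewrite !addr_gt0.
have := le0 s p; have := le1 s p; have := le2 s p.
rewrite /lyap /d1 /y1 /y2.
have : 0 <= B0 * `|s - p| ^+ 2 by rewrite mulr_ge0 ?exprn_ge0 ?(ltW B00).
by lra.
Qed.

Lemma lyap_lower : exists2 al : R, 0 < al &
  forall s, al * `|s - p| ^+ 2 <= lyap s.
Proof.
have [c00 c000 lowP] := posdef_coercive hP.
have [CT CT0 leT] := norm_mulmx (Tu *m P); have [CK CK0 leK] := norm_mulmx K2.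
have [CL CL0 leL] := norm_mulmx LB; have [CJ CJ0 leJ] := norm_mulmx J.
pose C := 1 + CJ + CL * (CT + CK).
have C0 : 0 < C by rewrite !addr_gt0// mulr_gt0// addr_gt0.
pose c := Num.min (c00 / 2) (Num.min c1 c2).
have c0 : 0 < c by rewrite !lt_min divr_gt0// c10.
exists (c / C ^+ 2) => [|s]; first by rewrite divr_gt0// exprn_gt0.
pose S2 := sqnorm2 (d1 s) + sqnorm2 (y1 s) + sqnorm2 (y2 s).
have [a1 a2 a3] : [/\ 0 <= sqnorm2 (d1 s), 0 <= sqnorm2 (y1 s)
  & 0 <= sqnorm2 (y2 s)] by split; exact: sqnorm2_ge0.
have S20 : 0 <= S2 by rewrite !addr_ge0.
have V_ge : c * S2 <= lyap s.
  have := lowP (d1 s); have := lowQ1 (y1 s); have := lowQ2 (y2 s).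
  have [ca [cb cc]] : c <= c00 / 2 /\ c <= c1 /\ c <= c2.
    by rewrite !ge_min !lexx !orbT.
  have := ler_wpM2r a1 ca; have := ler_wpM2r a2 cb; have := ler_wpM2r a3 cc.
  by rewrite /lyap /S2; lra.
apply: le_trans V_ge; rewrite -mulrA ler_pM2l// mulrC ler_pdivrMr ?exprn_gt0//.
pose mu := Num.sqrt S2; have mu0 : 0 <= mu by exact: sqrtr_ge0.
have muE : mu ^+ 2 = S2 by exact: sqr_sqrtr.
have le_mu j (v : 'cV[R]_j) : sqnorm2 v <= S2 -> `|v| <= mu.
  move=> vS; rewrite -ler_sqr ?nnegrE// muE; apply: le_trans vS.
  exact: norm_sqnorm2.
have md : `|d1 s| <= mu by apply: le_mu; rewrite /S2; lra.
have m1 : `|y1 s| <= mu by apply: le_mu; rewrite /S2; lra.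
have m2 : `|y2 s| <= mu by apply: le_mu; rewrite /S2; lra.
rewrite -muE mulrC -exprMn ler_pXn2r ?nnegrE ?mulr_ge0 ?(ltW C0)//.
have d2E : s.2.2 - p.2.2 = y2 s - J *m d1 s.
  rewrite /y2 /fast_integrator opprD addrACA -mulmxBr -/(d1 s).
  by rewrite addrK.
have dxE : s.1 - p.1 = y1 s - LB *m du s.
  rewrite /y1 /fast_plant opprD addrACA -(mulmxBr LB) -/(du s).
  by rewrite addrK.
have du_le : `|du s| <= (CT + CK) * mu.
  rewrite /du input_diff -/(d1 s) -/(y2 s) mulmxA mulrDl.
  apply: le_trans (ler_normD _ _) _; apply: lerD.
    by apply: le_trans (leT _) _; rewrite ler_pM2l.
  by apply: le_trans (leK _) _; rewrite ler_pM2l.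
have CLm : 0 <= CL * (CT + CK) * mu by rewrite !mulr_ge0 ?addr_ge0 ?(ltW CL0) ?(ltW CT0) ?(ltW CK0).
have CJm : 0 <= CJ * mu by rewrite mulr_ge0 ?(ltW CJ0).
rewrite [leLHS]prod_normE ge_max; apply/andP; split.
  rewrite /= dxE; apply: le_trans (ler_normB _ _) _.
  have : `|LB *m du s| <= CL * ((CT + CK) * mu).
    by apply: le_trans (leL _) _; rewrite ler_pM2l.
  by rewrite /C; lra.
rewrite [leLHS]prod_normE ge_max; apply/andP; split.
  by rewrite /= -/(d1 s) /C; lra.
rewrite /= d2E; apply: le_trans (ler_normB _ _) _.
have : `|J *m d1 s| <= CJ * mu by apply: le_trans (leJ _) _; rewrite ler_pM2l.
by rewrite /C; lra.
Qed.

Lemma lyap_derive (x : R -> state) (t : R) :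
  is_derive t 1 x (cl_field S O K w (x t)) ->
  is_derive t 1 (lyap \o x)
    (lyap_rate (plA S) Q1 LB K1 K2 (ossHz O *m plC S) (N *m K2) Q2 J Tu Tz P
      tau1^-1 tau2^-1 (d1 (x t)) (y1 (x t)) (y2 (x t)) (gf (x t)) (gg (x t))).
Proof.
move=> /is_derive_pair[dX /is_derive_pair[dE1 dE2]].
have sub j (h : R -> 'cV[R]_j) (c v : 'cV[R]_j) : is_derive t 1 h v ->
    is_derive t 1 (fun i : R => h i - c) v.
  by move=> dh; apply: is_derive_eq; rewrite subr0.
set v1 := (cl_field S O K w (x t)).2.1 in dE1.
set v2 := (cl_field S O K w (x t)).2.2 in dE2.
have dd1 : is_derive t 1 (d1 \o x) v1 by exact: sub.
have dU : is_derive t 1 (fun i : R => cl_u K (x i)) (K1 *m v1 + K2 *m v2).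
  exact: is_deriveD (is_derive_mulmx K1 dE1) (is_derive_mulmx K2 dE2).
have dy1 : is_derive t 1 (y1 \o x)
    ((cl_field S O K w (x t)).1 + LB *m (K1 *m v1 + K2 *m v2)).
  by apply: sub; exact: is_deriveD dX (is_derive_mulmx LB dU).
have dy2 : is_derive t 1 (y2 \o x) (v2 + J *m v1).
  by apply: sub; exact: is_deriveD dE2 (is_derive_mulmx J dE1).
have q0 := is_derive_quad symP dd1.
have q1 := is_derive_quad symQ1 dy1; have q2 := is_derive_quad symQ2 dy2.
rewrite /lyap; apply: is_derive_eq.
rewrite /lyap_rate /v1 /v2 (field_plant _ eqp) (field_slow _ eqp).
rewrite (field_integrator _ eqp) /= -/(y1 _) -/(y2 _) -/(gf _) -/(gg _) -/(d1 _).
by rewrite /GRing.scale/=; field.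
Qed.

Let small (s : state) := [/\ `|du s| <= rho / 2, `|dz s| <= rho / 2,
  `|Tu *m (P *m d1 s)| <= rho / 2 & `|Tz *m (P *m d1 s)| <= rho / 2].

Let rho2 (x : R) : x <= rho / 2 -> x <= rho.
Proof. by have := rho0; lra. Qed.

Lemma small_near : exists2 e : R, 0 < e & forall s, `|s - p| <= e -> small s.
Proof.
have [Cu Cu0 leu] := lip_input; have [Cz Cz0 lez] := lip_output w.
have [Ca Ca0 lea] := lip_mulmx Tu (lip_mulmx P lip_slow).
have [Cb Cb0 leb] := lip_mulmx Tz (lip_mulmx P lip_slow).
pose C := Cu + Cz + Ca + Cb; have C0 : 0 < C by rewrite !addr_gt0.
exists (rho / 2 / C) => [|s]; first by rewrite !divr_gt0.
rewrite ler_pdivlMr// => sC.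
have leC (x c : R) : x <= c * `|s - p| -> c <= C -> x <= rho / 2.
  move=> xc cC; apply: le_trans xc _; apply: le_trans sC.
  by rewrite mulrC ler_wpM2l.
have := leu s p; have := lez s p; have := lea s p; have := leb s p.
rewrite -!mulmxBr => lb la lz lu; split.
- by apply: leC lu _; rewrite /C; lra.
- by apply: leC lz _; rewrite /C; lra.
- by apply: leC la _; rewrite /C; lra.
- by apply: leC lb _; rewrite /C; lra.
Qed.

(** The decay of lyap has no term in the deviation d1 of the gradient integrator;
    this deviation is controlled by the other terms through slow_bound. *)
Lemma lyap_bound : exists2 C : R, 0 < C & forall s, small s ->
  lyap s <= C * (sqnorm2 (y1 s) + sqnorm2 (y2 s) +
                 sqnorm2 (gf s) + sqnorm2 (gg s)).
Proof.
have [Cs Cs0 slow] := slow_bound Ww (equilibrium_optimal eqp) rho0 L0 smf smg.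
have [CP CP0 boundP] := dot_mulmx_bound P.
have [B1 B10 bound1] := dot_mulmx_bound Q1.
have [B2 B20 bound2] := dot_mulmx_bound Q2.
have [Ci Ci0 lei] := sqnorm2_mulmx (invmx P).
have [CK CK0 leK] := sqnorm2_mulmx K2.
have [CC CC0 leC] := sqnorm2_mulmx (plC S).
have [CG CG0 leG] := sqnorm2_mulmx (Gu *m K2).
pose C0 := (1 + CP) * (Ci * Cs) * (1 + CK + 2 * CC + 2 * CG).
have C00 : 0 < C0 by rewrite !mulr_gt0 ?addr_gt0 ?mulr_gt0.
exists (C0 + (1 + B1) + (1 + B2)) => [|s [du_s dz_s tu_s tz_s]].
  by rewrite !addr_gt0.
have := slow (P *m d1 s) (cl_u K s) (cl_z S K w s)
  (rho2 tu_s) (rho2 tz_s) (rho2 du_s) (rho2 dz_s).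
have -> : cl_u K s - cl_u K p - Tu *m (P *m d1 s) = K2 *m y2 s.
  by rewrite input_diff -/(d1 s) -/(y2 s) addrC addKr.
have -> : cl_z S K w s - cl_z S K w p - Tz *m (P *m d1 s) =
    plC S *m y1 s + Gu *m K2 *m y2 s.
  rewrite output_diff -/(d1 s) -/(y1 s) -/(y2 s).
  by rewrite -(addrA (Tz *m _)) (addrC (Tz *m _)) addrK.
rewrite -/(gf s) -/(gg s) => slow_le.
set E := sqnorm2 (y1 s) + sqnorm2 (y2 s) + sqnorm2 (gf s) + sqnorm2 (gg s).
have [n1 n2 nf ng] : [/\ 0 <= sqnorm2 (y1 s), 0 <= sqnorm2 (y2 s),
  0 <= sqnorm2 (gf s) & 0 <= sqnorm2 (gg s)] by split; exact: sqnorm2_ge0.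
have [E1 E2] : sqnorm2 (y1 s) <= E /\ sqnorm2 (y2 s) <= E by rewrite /E; split; lra.
have scale (x y c : R) : 0 < c -> x <= c * y -> y <= E -> x <= c * E.
  by move=> c_gt0 xy yE; apply: le_trans xy _; rewrite ler_pM2l.
have sK := scale _ _ _ CK0 (leK _) E2.
have sC := scale _ _ _ CC0 (leC _) E1.
have sG := scale _ _ _ CG0 (leG _) E2.
have sum_le := sqnorm2D (plC S *m y1 s) (Gu *m K2 *m y2 s).
have xi_le : sqnorm2 (P *m d1 s) <= Cs * ((1 + CK + 2 * CC + 2 * CG) * E).
  apply: le_trans slow_le _; rewrite ler_pM2l//.
  have : sqnorm2 (gf s) + sqnorm2 (gg s) <= E by rewrite /E; lra.
  by lra.
have d1_le : sqnorm2 (d1 s) <= Ci * (Cs * ((1 + CK + 2 * CC + 2 * CG) * E)).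
  rewrite -[X in sqnorm2 X <= _](mulKmx (posdef_unit hP)).
  by apply: le_trans (lei _) _; rewrite ler_pM2l.
have quad j (v : 'cV[R]_j) (Q : 'M[R]_j) (B e : R) : 0 < B ->
    `|dot v (Q *m v)| <= 1 * sqnorm2 v + B / 1 * sqnorm2 v ->
    sqnorm2 v <= e -> dot v (Q *m v) <= (1 + B) * e.
  move=> B_gt0 + ve; rewrite divr1 -mulrDl => /(le_trans (ler_norm _))/le_trans.
  by apply; rewrite ler_pM2l// addr_gt0.
have q0 := quad _ _ _ _ _ CP0 (boundP _ _ 1 ltr01) d1_le.
have q1 := quad _ _ _ _ _ B10 (bound1 _ _ 1 ltr01) E1.
have q2 := quad _ _ _ _ _ B20 (bound2 _ _ 1 ltr01) E2.
have CE : 0 <= C0 * E by rewrite mulr_ge0 ?(ltW C00)// !addr_ge0.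
have q0' : dot (d1 s) (P *m d1 s) <= C0 * E by rewrite /C0 -!mulrA in q0 *.
by rewrite /lyap; lra.
Qed.

Lemma field_lipschitz : exists2 C : R, 0 < C & forall a b, small a -> small b ->
  `|cl_field S O K w a - cl_field S O K w b| <= C * `|a - b|.
Proof.
have [C1 C10 le1] : lip (fun s : state => (cl_field S O K w s).1).
  apply: lip_add; last exact: lip_cst.
  apply: lip_add; apply: lip_mulmx; last exact: lip_input.
  by apply: lip_fst; exact: lip_id.
have [C2 C20 le2] : lip (fun s : state => cl_e S O K w s).
  apply: lip_add; last exact: lip_cst.
  apply: lip_add; apply: lip_mulmx; last exact: lip_input.
  exact: lip_output.
have [Cu Cu0 leu] := lip_input; have [Cz Cz0 lez] := lip_output w.
have [Ca Ca0 lea] := norm_mulmx Tu^T; have [Cb Cb0 leb] := norm_mulmx Tz^T.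
pose C3 := Ca * (L * Cu) + Cb * (L * Cz).
have C30 : 0 < C3 by rewrite addr_gt0// !mulr_gt0.
exists (C1 + tau1^-1 * C3 + tau2^-1 * C2) => [|a b [ua za _ _] [ub zb _ _]].
  by rewrite !addr_gt0 ?mulr_gt0 ?invr_gt0.
set d := `|a - b|; have d0 : 0 <= d by exact: normr_ge0.
have [t1 t2] : 0 < tau1^-1 /\ 0 < tau2^-1 by rewrite !invr_gt0.
have p1 : 0 <= C1 * d by rewrite mulr_ge0// ltW.
have p2 : 0 <= tau2^-1 * C2 * d by rewrite !mulr_ge0// ltW.
have p3 : 0 <= tau1^-1 * C3 * d by rewrite !mulr_ge0// ltW.
rewrite [leLHS]prod_normE ge_max; apply/andP; split.
  by apply: le_trans (le1 a b) _; rewrite -/d; lra.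
rewrite [leLHS]prod_normE ge_max; apply/andP; split.
  rewrite /= -scalerBr normrZ gtr0_norm//.
  apply: (@le_trans _ _ (tau1^-1 * (C3 * d))); last by lra.
  rewrite ler_pM2l// opprD !opprK addrACA mulrDl.
  apply: le_trans (ler_normD _ _) _.
  rewrite [X in `|X| + _]addrC [X in _ + `|X|]addrC -!mulmxBr -!mulrA.
  apply: lerD.
    apply: le_trans (lea _) _; rewrite ler_pM2l// distrC.
    apply: le_trans (smf.2 _ _ (rho2 ua) (rho2 ub)) _.
    by rewrite ler_pM2l//; exact: leu.
  apply: le_trans (leb _) _; rewrite ler_pM2l// distrC.
  apply: le_trans (smg.2 _ _ (rho2 za) (rho2 zb)) _.
  by rewrite ler_pM2l//; exact: lez.
rewrite /= -scalerBr normrZ gtr0_norm//.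
apply: (@le_trans _ _ (tau2^-1 * (C2 * d))); last by lra.
rewrite ler_pM2l// opprK addrC distrC.
exact: le2.
Qed.

Lemma cocoercive_small s : small s ->
  kap * sqnorm2 (gf s) <= dot (gf s) (du s) /\
  kap * sqnorm2 (gg s) <= dot (gg s) (dz s).
Proof.
move=> [du_s dz_s _ _].
have bound (x d B : R) : 0 < B -> x <= B * d -> 0 <= x -> kap * B <= 1 ->
    kap * x <= d.
  move=> B0 xd x0 kB; have d0 : 0 <= d by rewrite -(pmulr_rge0 _ B0); lra.
  apply: (@le_trans _ _ (kap * B * d)); last by rewrite ler_piMl.
  by rewrite -mulrA ler_pM2l.
have pos j : 0 < 2 * j.+1%:R * L by rewrite !mulr_gt0// ltr0n.
split.
  apply: bound kap_f; [exact: pos | | exact: sqnorm2_ge0].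
  exact: (cocoercive (ass_f hSO) L0 smf du_s).
apply: bound kap_g; [exact: pos | | exact: sqnorm2_ge0].
exact: (cocoercive (ass_g hSO) L0 smg dz_s).
Qed.

Lemma closed_loop_stable :
  locally_exp_stable (cl_dom S K w) (cl_field S O K w) p.
Proof.
have [al al0 low] := lyap_lower; have [be be0 up] := lyap_upper.
have [C C0 bound] := lyap_bound; have [LF LF0 lipF] := field_lipschitz.
have [e e0 near_small] := small_near.
have lam0 : 0 < k / (2 * C) by rewrite divr_gt0// mulr_gt0.
apply: (@lyapunov_exp_stable _ _ _ _ _ p lyap e al be (k / (2 * C)) LF) => //.
- apply: curve_calculus_prod; first exact: curve_calculus_cV.
  by apply: curve_calculus_prod; exact: curve_calculus_cV.
- move=> s /near_small[us zs _ _]; split.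
    by apply: smf.1; exact: rho2.
  by apply: smg.1; exact: rho2.
- by move=> a b /near_small sa /near_small sb; exact: lipF.
- exact: lyap_continuous.
move=> x t /near_small small_x dx.
have [cf cg] := cocoercive_small small_x.
rewrite /du input_diff in cf; rewrite /dz output_diff in cg.
have dV := lyap_derive dx; eexists; last exact: dV.
apply: le_trans (decay cf cg) _; rewrite lerN2.
have -> : 2 * (k / (2 * C)) * lyap (x t) = k * (lyap (x t) / C).
  by field; rewrite gt_eqF.
by rewrite ler_pM2l// ler_pdivrMr// mulrC; exact: bound.
Qed.

End AtEquilibrium.

End Problem.

(** * Solution of the optimal steady-state control problem *)

Theorem mainTheorem2 (R : realType) (n m r nw nc q : nat)
  (S : plant R n m r nw) (O : oss_problem R m r nw nc)
  (hA : hurwitz (plA S))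
  (hSO : standing_assumptions S O)
  (z0 : 'cV[R]_nw -> 'cV[R]_r) (u0 : 'cV[R]_nw -> 'cV[R]_m)
  (h0 : forall w, ossW O w ->
    block_mx 1%:M (- dcgain_u S) (ossHz O) (ossHu O)
      *m col_mx (z0 w) (u0 w)
    = col_mx (dcgain_w S) (- ossHw O) *m w)
  (Tz : 'M[R]_(r, q)) (Tu : 'M[R]_(m, q))
  (hTrank : \rank (col_mx Tz Tu) = q)
  (hTrange : forall v : 'cV[R]_(r + m),
    (exists xi : 'cV[R]_q, v = col_mx Tz Tu *m xi) <->
    block_mx 1%:M (- dcgain_u S) (ossHz O) (ossHu O) *m v = 0)
  (N : 'M[R]_(nc, m)) (hN : N = ossHz O *m dcgain_u S + ossHu O)
  (hNrank : \rank N = nc)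
  (hconv : forall w, ossW O w ->
    strongly_convex_on
      [set xi : 'cV[R]_q | ossU O (Tu *m xi + u0 w)]
      (fun xi : 'cV[R]_q =>
         (ossf O (Tu *m xi + u0 w)%R
          + ossg O (Tz *m xi + z0 w)%R)%E))
  (K2 : 'M[R]_(m, nc)) (hK2 : hurwitz (- (N *m K2)))
  (Pic : 'M[R]_m)
  (hPic : Pic = 1%:M - K2 *m invmx (N *m K2) *m N)
  (P : 'M[R]_q) (hP : posdef P)
  (K1 : 'M[R]_(m, q)) (hK1rank : \rank K1 = q)
  (hK1 : Pic *m K1 = Tu *m P) :
  exists2 tau2s : R, 0 < tau2s & forall tau2 : R, tau2s < tau2 ->
  exists2 tau1s : R, 0 < tau1s & forall tau1 : R, tau1s < tau1 ->
    solves_OSS S O (gradient_controller O Tz Tu K1 K2 tau1 tau2).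
Proof.
subst N Pic.
set N := ossHz O *m dcgain_u S + ossHu O in hK2 hK1 hNrank.
have unitA := hurwitz_unit hA.
have unitNK : N *m K2 \in unitmx.
  by rewrite -[N *m K2]opprK -scaleN1r unitmxZ ?hurwitz_unit// unitrN1.
have [Q1 [c1 [symQ1 c10 lowQ1 decA]]] := hurwitz_lyapunov hA.
have [Q2 [c2 [symQ2 c20 lowQ2 decNK]]] := hurwitz_lyapunov hK2.
have {}decNK v : c2 * sqnorm2 v <= dot v (Q2 *m (N *m K2 *m v)).
  by have := decNK v; rewrite mulNmx mulmxN dotNr lerN2.
have [L L0 smooth] := uniform_smoothness hSO h0 hTrange hconv unitNK.
pose J := invmx (N *m K2) *m (N *m K1).
have [e2s e2s0 fast] := lyap_rate_decay (invmx (plA S) *m plB S) K1 K2 (plC S)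
  (dcgain_u S *m K2) (ossHz O *m plC S) J Tu Tz hP.1 c10 c20 decA decNK.
(* both gradients are cocoercive with this constant near every optimizer *)
pose kap := (2 * (m + r).+1%:R * L)^-1.
have kap0 : 0 < kap by rewrite invr_gt0 !mulr_gt0// ltr0n.
have kap_le j : (j <= m + r)%N -> kap * (2 * j.+1%:R * L) <= 1.
  move=> jmr; rewrite /kap mulrC ler_pdivrMr ?mulr_gt0 ?ltr0n// mul1r.
  by rewrite ler_pM2r// ler_pM2l// ler_nat ltnS.
have inv_lt (e t : R) : 0 < e -> e^-1 < t -> 0 < t^-1 /\ t^-1 < e.
  move=> e0 et; have t0 : 0 < t by apply: lt_trans et; rewrite invr_gt0.
  by rewrite invr_gt0 invf_plt ?posrE.
exists e2s^-1 => [|tau2 tau2_large]; first by rewrite invr_gt0.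
have [e20 e2_lt] := inv_lt _ _ e2s0 tau2_large.
have tau20 : 0 < tau2 by rewrite -invr_gt0.
have [e1s e1s0 slow] := fast tau2^-1 kap e20 e2_lt kap0.
exists e1s^-1 => [|tau1 tau1_large w Ww]; first by rewrite invr_gt0.
have [e10 e1_lt] := inv_lt _ _ e1s0 tau1_large.
have tau10 : 0 < tau1 by rewrite -invr_gt0.
have [k k0 decay] := slow tau1^-1 e10 e1_lt.
have [p eqp] := equilibrium_exists hSO hTrange unitNK unitA hP hK1 tau10 tau20 Ww.
have opt := equilibrium_optimal hSO hTrange unitA tau10 tau20 eqp.
have [rho rho0 [smf smg]] := smooth w Ww _ _ opt.
exists p; split=> //.
  move=> p'; exact: (equilibrium_unique hSO h0 hTrank hTrange hconv unitNK unitA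
    hP hK1 tau10 tau20 Ww eqp).
exact: (closed_loop_stable hSO h0 hTrange hconv unitA hP hK1 tau10 tau20 Ww eqp
  rho0 L0 smf smg symQ1 symQ2 c10 c20 kap0 k0 lowQ1 lowQ2
  (kap_le m (leq_addr _ _)) (kap_le r (leq_addl _ _)) decay).
Qed.
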